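(* Let $n\ge 1$. There exists a linear function $D$ (with values in $\mathbb{R}$) on the real vector space of conewise-polynomial functions on $(\mathbb{R}^n)^*$ such that $$D\bigl(A_1(\cdot)\,A_2(\cdot)\cdots A_n(\cdot)\bigr)=A_1\cdot A_2\cdot\ldots\cdot A_n$$ for every collection of polytopes $A_1,\ldots,A_n$ in $\mathbb{R}^n$, where the left-hand side involves the pointwise product of the support functions and the right-hand side is the mixed volume.
   Context: A polytope in $\mathbb{R}^n$ is the convex hull of a finite non-empty set (vertices need not be rational). The support function of a polytope $A\subset\mathbb{R}^n$ is $A(\cdot):(\mathbb{R}^n)^*\to\mathbb{R}$, $A(v)=\max_{a\in A} v\cdot a$. A function on a finite-dimensional real vector space is conewise-polynomial if it is polynomial on every piece of a finite subdivision of the space into polyhedral cones with vertices at $0$. The mixed volume $A_1\cdot\ldots\cdot A_n$ of polytopes $A_1,\ldots,A_n\subset\mathbb{R}^n$ is the coefficient of the monomial $x_1\cdots x_n$ in the polynomial $\mathrm{Vol}(x_1A_1+\ldots+x_nA_n)$ of the variables $x_1,\ldots,x_n\ge 0$ (so that $A\cdot\ldots\cdot A=n!\,\mathrm{Vol}(A)$), where $\mathrm{Vol}$ is the standard volume on $\mathbb{R}^n$ and sums are Minkowski sums. *)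

(* Defs.v *)
From HB Require Import structures.
From mathcomp Require Import all_boot all_order all_algebra.
From mathcomp Require Import all_classical all_reals all_analysis.
(* The notations of mpoly clash with those of analysis. *)
From mathcomp Require Import -(notations) mpoly.

Set Implicit Arguments.
Unset Strict Implicit.
Unset Printing Implicit Defensive.

Import Order.TTheory GRing.Theory Num.Theory.

Local Open Scope classical_set_scope.
Local Open Scope ring_scope.

(* R^n is 'cV[R]_n and its dual is 'rV[R]_n. *)
Definition pairing (R : realType) (n : nat) (v : 'rV[R]_n) (a : 'cV[R]_n) : R :=
  (v *m a) 0 0.

Definition convex_hull (R : realType) (n : nat) (X : set 'cV[R]_n) :
    set 'cV[R]_n :=
  [set x | exists (k : nat) (a : 'I_k -> 'cV[R]_n) (w : 'I_k -> R),
     [/\ forall i, X (a i), forall i, 0 <= w i, \sum_i w i = 1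
       & x = \sum_i w i *: a i]].

Record polytope (R : realType) (n : nat) := Polytope {
  polytope_set :> set 'cV[R]_n;
  polytopeP : exists X : set 'cV[R]_n,
    [/\ finite_set X, X !=set0 & polytope_set = convex_hull X]
}.

(* For a polytope this supremum is a maximum, see support_max. *)
Definition support (R : realType) (n : nat) (A : set 'cV[R]_n) (v : 'rV[R]_n) : R :=
  sup [set pairing v a | a in A].

Definition polyhedral_cone (R : realType) (n : nat) (C : set 'rV[R]_n) : Prop :=
  exists2 B : set 'cV[R]_n, finite_set B &
    C = [set v | forall b, B b -> 0 <= pairing v b].

(* F is cut out of C by a supporting hyperplane through 0; a = 0 gives C itself. *)
Definition face_of (R : realType) (n : nat) (F C : set 'rV[R]_n) : Prop :=
  exists2 a : 'cV[R]_n, (forall v, C v -> 0 <= pairing v a) &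
    F = C `&` [set v | pairing v a = 0].

(* The cones need not be pointed nor full-dimensional. *)
Definition cone_subdivision (R : realType) (n : nat)
    (S : set (set 'rV[R]_n)) : Prop :=
  [/\ finite_set S,
      (forall C, S C -> polyhedral_cone C),
      \bigcup_(C in S) C = setT
    & forall C C', S C -> S C' -> face_of (C `&` C') C /\ face_of (C `&` C') C'].

Definition polynomial_on (R : realType) (n : nat) (f : 'rV[R]_n -> R)
    (C : set 'rV[R]_n) : Prop :=
  exists p : mpoly n R, forall v, C v -> f v = meval (fun i => v 0 i) p.

Definition conewise_polynomial (R : realType) (n : nat)
    (f : 'rV[R]_n -> R) : Prop :=
  exists2 S, cone_subdivision S & forall C, S C -> polynomial_on f C.

Section ConewisePolynomial.
Variables (R : realType) (n : nat).
Implicit Types (v : 'rV[R]_n) (a b : 'cV[R]_n) (C : set 'rV[R]_n).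

Lemma pairingD v a b : pairing v (a + b) = pairing v a + pairing v b.
Proof. by rewrite /pairing mulmxDr mxE. Qed.

Lemma pairingB v a b : pairing v (a - b) = pairing v a - pairing v b.
Proof. by rewrite /pairing mulmxBr !mxE. Qed.

Lemma pairing0 v : pairing v 0 = 0.
Proof. by rewrite /pairing mulmx0 mxE. Qed.

Lemma pairing_sum v k (w : 'I_k -> R) (a : 'I_k -> 'cV[R]_n) :
  pairing v (\sum_i w i *: a i) = \sum_i w i * pairing v (a i).
Proof.
rewrite /pairing mulmx_sumr summxE; apply: eq_bigr => i _.
by rewrite -scalemxAr mxE.
Qed.

Lemma polyhedral_coneI C C' :
  polyhedral_cone C -> polyhedral_cone C' -> polyhedral_cone (C `&` C').
Proof.
move=> [B fB ->] [B' fB' ->]; exists (B `|` B'); first by rewrite finite_setU.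
apply/seteqP; split=> v /=; first by move=> [h h'] b [/h|/h'].
by move=> h; split=> b Bb; apply: h; [left|right].
Qed.

Lemma face_ofI C C' D D' : face_of (C `&` D) C -> face_of (C' `&` D') C' ->
  face_of ((C `&` C') `&` (D `&` D')) (C `&` C').
Proof.
move=> [a a0 CD] [a' a'0 CD']; exists (a + a').
  by move=> v [Cv C'v]; rewrite pairingD addr_ge0 ?a0 ?a'0.
rewrite setIACA CD CD'; apply/seteqP; split=> v /=.
  by move=> [[? va] [? va']]; rewrite pairingD va va' addr0.
move=> [[Cv C'v]]; rewrite pairingD => /eqP.
by rewrite paddr_eq0 ?a0 ?a'0// => /andP[/eqP va /eqP va'].
Qed.

Definition refinement (S S' : set (set 'rV[R]_n)) : set (set 'rV[R]_n) :=
  [set C `&` C' | C in S & C' in S'].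

Lemma refinementP S S' :
  cone_subdivision S -> cone_subdivision S' -> cone_subdivision (refinement S S').
Proof.
move=> [fS cS uS iS] [fS' cS' uS' iS']; split.
- exact: finite_image2.
- by move=> _ [C SC [C' SC' <-]]; apply: polyhedral_coneI; [exact: cS|exact: cS'].
- apply/seteqP; split=> // v _.
  have : setT v by []; rewrite -{1}uS => -[C SC Cv].
  have : setT v by []; rewrite -{1}uS' => -[C' SC' C'v].
  by exists (C `&` C') => //; exists C => //; exists C'.
- move=> _ _ [C SC [C' SC' <-]] [D SD [D' SD' <-]].
  have [CD DC] := iS _ _ SC SD; have [CD' DC'] := iS' _ _ SC' SD'.
  split; first exact: face_ofI.
  rewrite (setIC (C `&` C')); apply: face_ofI; first by rewrite setIC.
  by rewrite setIC.
Qed.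

Lemma conewise_polynomial2 (op : R -> R -> R)
    (mop : mpoly n R -> mpoly n R -> mpoly n R) (f g : 'rV[R]_n -> R) :
  (forall h p q, meval h (mop p q) = op (meval h p) (meval h q)) ->
  conewise_polynomial f -> conewise_polynomial g ->
  conewise_polynomial (fun v => op (f v) (g v)).
Proof.
move=> mopE [S cS fS] [S' cS' gS']; exists (refinement S S').
  exact: refinementP.
move=> _ [C SC [C' SC' <-]].
have [p fp] := fS _ SC; have [q gq] := gS' _ SC'.
by exists (mop p q) => v [Cv C'v]; rewrite mopE fp// gq.
Qed.

Lemma conewise_polynomial_cst (c : R) :
  conewise_polynomial (fun _ : 'rV[R]_n => c).
Proof.
exists [set setT].
  split.
  - exact: finite_set1.
  - move=> _ ->; exists set0; first exact: finite_set0.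
    by apply/seteqP; split=> // v _ b [].
  - by rewrite bigcup_set1.
  - move=> _ _ -> ->; rewrite setIT.
    have faceT : face_of setT [set: 'rV[R]_n].
      exists 0 => [v _|]; first by rewrite pairing0.
      by apply/seteqP; split=> // v _; split=> //=; rewrite pairing0.
    by split.
by move=> _ ->; exists (mpolyC n c) => v _; rewrite mevalC.
Qed.

Lemma conewise_polynomialD (f g : 'rV[R]_n -> R) :
  conewise_polynomial f -> conewise_polynomial g ->
  conewise_polynomial (fun v => f v + g v).
Proof. by apply: (@conewise_polynomial2 _ +%R) => h p q; rewrite mevalD. Qed.

Lemma conewise_polynomialM (f g : 'rV[R]_n -> R) :
  conewise_polynomial f -> conewise_polynomial g ->
  conewise_polynomial (fun v => f v * g v).
Proof. by apply: (@conewise_polynomial2 _ *%R) => h p q; rewrite mevalM. Qed.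

Definition conewise_polynomial_pred : {pred ('rV[R]_n -> R^o)} :=
  fun f => `[< conewise_polynomial f >].

Lemma conewise_polynomial_submod : submod_closed conewise_polynomial_pred.
Proof.
split=> [|c f g /asboolP cf /asboolP cg]; apply/asboolP.
  exact: conewise_polynomial_cst.
apply: conewise_polynomialD => //.
exact: (conewise_polynomialM (conewise_polynomial_cst c)).
Qed.

HB.instance Definition _ :=
  GRing.isSubmodClosed.Build R ('rV[R]_n -> R^o) conewise_polynomial_pred
    conewise_polynomial_submod.

(* The real vector space of conewise-polynomial functions on the dual of R^n,
   as a linear subspace of the space of all functions. *)
Record cpoly := CPoly {
  cpoly_fun :> 'rV[R]_n -> R^o;
  cpoly_funP : cpoly_fun \in conewise_polynomial_pred
}.

HB.instance Definition _ := [isSub for cpoly_fun].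
HB.instance Definition _ := [Choice of cpoly by <:].
HB.instance Definition _ := [SubChoice_isSubLmodule of cpoly by <:].

End ConewisePolynomial.

Section SupportFunction.
Variables (R : realType) (n : nat).
Implicit Types (v : 'rV[R]_n) (a b : 'cV[R]_n).

Lemma finite_argmax (X : set 'cV[R]_n) v : finite_set X -> X !=set0 ->
  exists2 a, X a & forall b, X b -> pairing v b <= pairing v a.
Proof.
move=> /finite_seqP[s ->] [a0 /= a0s].
have i0 : 'I_(size s) by exists (index a0 s); rewrite index_mem.
case: (@arg_maxP _ _ _ i0 xpredT (fun i => pairing v (tnth (in_tuple s) i)) isT).
move=> i _ imax; exists (tnth (in_tuple s) i); first exact: mem_tnth.
by move=> b /= /(tnthP (in_tuple s))[j ->]; exact: imax.
Qed.

Lemma sub_convex_hull (X : set 'cV[R]_n) : X `<=` convex_hull X.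
Proof.
move=> a Xa; exists 1%N, (fun=> a), (fun=> 1); split=> //.
  by rewrite big_ord1.
by rewrite big_ord1 scale1r.
Qed.

Lemma support_hull (X : set 'cV[R]_n) v a : X a ->
  (forall b, X b -> pairing v b <= pairing v a) ->
  forall x, convex_hull X x -> pairing v x <= pairing v a.
Proof.
move=> Xa amax _ [k [b [w [Xb w0 w1 ->]]]].
rewrite pairing_sum -[leRHS]mul1r -w1 mulr_suml.
by apply: ler_sum => i _; rewrite ler_wpM2l// amax.
Qed.

Lemma supportE (A : set 'cV[R]_n) v a : A a ->
  (forall b, A b -> pairing v b <= pairing v a) -> support A v = pairing v a.
Proof.
move=> Aa amax; apply/eqP; rewrite eq_le; apply/andP; split.
  by apply: ge_sup; [exists (pairing v a), a | move=> _ [b Ab <-]; exact: amax].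
apply: ub_le_sup; last by exists a.
by exists (pairing v a) => _ [b Ab <-]; exact: amax.
Qed.

Lemma support_max (A : polytope R n) v :
  exists2 a, polytope_set A a & support A v = pairing v a /\
                   forall b, polytope_set A b -> pairing v b <= pairing v a.
Proof.
have [X [fX X0 ->]] := polytopeP A.
have [a Xa amax] := finite_argmax v fX X0.
have amax' := support_hull Xa amax.
by exists a; [exact: sub_convex_hull|split=> //; apply: supportE => //;
  exact: sub_convex_hull].
Qed.

Lemma support_conewise_polynomial (A : polytope R n) :
  conewise_polynomial (support A).
Proof.
have [X [fX X0 ->]] := polytopeP A.
pose C a := [set v | forall b, X b -> pairing v b <= pairing v a].
have CI a b : X a -> X b -> face_of (C a `&` C b) (C a).
  move=> Xa Xb; exists (a - b).
    by move=> v Cv; rewrite pairingB subr_ge0 Cv.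
  apply/seteqP; split=> v /= [Cav].
    move=> Cbv; split=> //; apply/eqP; rewrite pairingB subr_eq0 eq_le.
    by rewrite Cav// Cbv.
  by rewrite pairingB => /eqP; rewrite subr_eq0 => /eqP vab; split=> // c Xc;
    rewrite -vab Cav.
exists (C @` X).
  split.
  - exact: finite_image.
  - move=> _ [a Xa <-]; exists ((fun b => a - b) @` X).
      exact: finite_image.
    apply/seteqP; split=> v /=.
      by move=> Cav _ [b Xb <-]; rewrite pairingB subr_ge0 Cav.
    by move=> h b Xb; rewrite -subr_ge0 -pairingB h//; exists b.
  - apply/seteqP; split=> // v _.
    have [a Xa amax] := finite_argmax v fX X0.
    by exists (C a) => //; exists a.
  - move=> _ _ [a Xa <-] [b Xb <-]; split; first exact: CI.
    by rewrite setIC; exact: CI.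
move=> _ [a Xa <-].
exists (\sum_(i < n) a i 0 *: mpolyX R (mnm1 i)) => v Cav.
rewrite (@supportE _ v a); first last.
- exact: support_hull.
- exact: sub_convex_hull.
rewrite /pairing mxE raddf_sum; apply: eq_bigr => i _ /=.
by rewrite mevalZ mevalXU mulrC.
Qed.

Lemma support_prod_conewise_polynomial (A : 'I_n -> polytope R n) :
  (fun v => \prod_(i < n) support (A i) v) \in @conewise_polynomial_pred R n.
Proof.
apply/asboolP; elim: (index_enum _) => [|i s IHs].
  by under eq_fun do rewrite big_nil; exact: conewise_polynomial_cst.
under eq_fun do rewrite big_cons.
by apply: conewise_polynomialM => //; exact: support_conewise_polynomial.
Qed.

Definition support_prod (A : 'I_n -> polytope R n) : cpoly R n :=
  CPoly (support_prod_conewise_polynomial A).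

End SupportFunction.

(* n-dimensional Lebesgue measure. The product measure is applied here to bare
   set functions, so no sigma-finiteness instance is needed to state it. *)
Fixpoint lebesgue_tuple (R : realType) (n : nat) :
    set (n.-tuple (measurableTypeR R)) -> \bar R :=
  match n with
  | 0 => \d_([tuple])
  | m.+1 => pushforward
      (lebesgue_measure \x @lebesgue_tuple R m)%E
      (fun p => [tuple of p.1 :: p.2])
  end.

Definition volume (R : realType) (n : nat) (A : set 'cV[R]_n) : \bar R :=
  lebesgue_tuple [set t : n.-tuple R | A (\col_i tnth t i)].

Definition minkowski_comb (R : realType) (n : nat) (k : nat) (x : 'I_k -> R)
    (A : 'I_k -> set 'cV[R]_n) : set 'cV[R]_n :=
  [set \sum_i x i *: a i | a in [set a : 'I_k -> 'cV[R]_n | forall i, A i (a i)]].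

(* m is the mixed volume of A_1, ..., A_n: Vol(x_1 A_1 + ... + x_n A_n) is a
   polynomial in x_1, ..., x_n >= 0 whose coefficient at x_1 ... x_n is m. *)
Definition is_mixed_volume (R : realType) (n : nat) (A : 'I_n -> set 'cV[R]_n)
    (m : R) : Prop :=
  exists2 P : mpoly n R,
    (forall x : 'I_n -> R, (forall i, 0 <= x i) ->
       volume (minkowski_comb x A) = (meval x P)%:E) &
    mcoeff (Multinom [tuple 1%N | _ < n]) P = m.

Lemma base_expansion_inj (N n : nat) (m m' : 'I_n -> nat) :
  (forall i, m i < N)%N -> (forall i, m' i < N)%N ->
  (\sum_i m i * N ^ i = \sum_i m' i * N ^ i)%N -> m =1 m'.
Proof.
elim: n m m' => [|n IHn] m m' mN m'N; first by move=> _ [].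
have N0 : (0 < N)%N by exact: leq_ltn_trans (mN ord0).
have step (u : 'I_n.+1 -> nat) : (\sum_i u i * N ^ i =
    (\sum_i u (lift ord0 i) * N ^ i) * N + u ord0)%N.
  rewrite big_ord_recl expn0 muln1 addnC big_distrl /=; congr addn.
  by apply: eq_bigr => i _; rewrite /bump /= add1n expnSr mulnA.
rewrite !step => E.
have E0 : m ord0 = m' ord0.
  by have := congr1 (modn^~ N) E; rewrite !modnMDl !modn_small.
have E1 : (fun i => m (lift ord0 i)) =1 (fun i => m' (lift ord0 i)).
  apply: IHn => //.
  by have := congr1 (divn^~ N) E; rewrite !divnMDl// !divn_small// !addn0.
by move=> i; case: (unliftP ord0 i) => [j ->|->//]; exact: E1.
Qed.

Lemma meval_nneg_eq0 (R : realType) (n : nat) (P : mpoly n R) :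
  (forall x : 'I_n -> R, (forall i, 0 <= x i) -> meval x P = 0) -> P = 0.
Proof.
move=> P0; set N := msize P.
pose e (m : multinom n) := (\sum_(i < n) m i * N ^ i)%N.
have mN m i : m \in msupp P -> (m i < N)%N.
  move=> mP; apply: leq_ltn_trans (msize_mdeg_lt mP).
  by rewrite mdegE (bigD1 i)//= leq_addr.
have e_inj : {in msupp P &, injective e}.
  move=> m m' mP m'P E; apply/mnmP.
  by apply: (base_expansion_inj _ _ E) => i; exact: mN.
pose q : {poly R} := \sum_(m <- msupp P) mcoeff m P *: 'X^(e m).
have q0 k : q.[k%:R] = 0.
  rewrite -(P0 (fun i => k%:R ^+ (N ^ i)%N)); last by move=> i; exact: exprn_ge0.
  rewrite mevalE horner_sum; apply: eq_bigr => m _.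
  rewrite hornerZ hornerXn; congr (_ * _).
  by rewrite -prodrXr; apply: eq_bigr => i _; rewrite -exprM mulnC.
have {}q0 : q = 0.
  apply: (@roots_geq_poly_eq0 _ _ [seq k%:R | k <- iota 0 (size q)]).
  - by apply/allP => _ /mapP[k _ ->]; rewrite rootE q0.
  - by rewrite map_inj_uniq ?iota_uniq//; exact: (mulrIn (oner_neq0 R)).
  - by rewrite size_map size_iota.
apply/mpolyP => m; rewrite mcoeff0.
have [mP|] := boolP (m \in msupp P); last by move/memN_msupp_eq0.
have := congr1 (fun r : {poly R} => r`_(e m)) q0.
rewrite coef0 coef_sum (bigD1_seq m) ?msupp_uniq//= coefZ coefXn eqxx mulr1.
rewrite big_seq_cond big1 ?addr0// => m' /andP[m'P m'm].
rewrite coefZ coefXn; case: eqP => [E|_]; last by rewrite mulr0.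
by rewrite (e_inj _ _ mP m'P E) eqxx in m'm.
Qed.

Lemma is_mixed_volume_unique (R : realType) (n : nat)
    (A : 'I_n -> set 'cV[R]_n) (m m' : R) :
  is_mixed_volume A m -> is_mixed_volume A m' -> m = m'.
Proof.
move=> [P AP <-] [Q AQ <-]; apply/eqP; rewrite -subr_eq0 -mcoeffB.
rewrite (@meval_nneg_eq0 _ _ (P - Q)) ?mcoeff0// => x x0.
by apply/eqP; rewrite mevalB subr_eq0 -eqe -AP// -AQ.
Qed.

(* Main.v *)
Require Import Defs.
From HB Require Import structures.
From mathcomp Require Import all_boot all_order all_algebra.
(* Loaded before the measure theory, which reuses some of its names. *)
From mathcomp Require Import -(notations) mpoly.
From mathcomp Require Import all_classical all_reals all_analysis.
From mathcomp Require Import measurable_realfun ring lra.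

Set Implicit Arguments.
Unset Strict Implicit.
Unset Printing Implicit Defensive.

Import Order.TTheory GRing.Theory Num.Theory.
Import numFieldNormedType.Exports.

Local Open Scope classical_set_scope.
Local Open Scope ring_scope.


(** Suppose that prescribing D(h_A^n) = n! Vol(A) on the n-th powers of support
    functions h_A is consistent with the linear relations between these powers.
    Then D exists: extend it from the span of the powers to all
    conewise-polynomial functions by Zorn's lemma ([linear_extension]).  It takes
    the right values on products because, for x >= 0, the function
    sum_i x_i h_(A_i) is the support function of the Minkowski combination
    sum_i x_i A_i; expanding its n-th power ([support_prod_minkowski]), linearity
    of D shows at once that n! Vol(sum_i x_i A_i) is a polynomial in x and that
    the coefficient of x_1 ... x_n in it is n! D(h_(A_1) ... h_(A_n)).

    Everything thus rests on [support_power_volume]: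
    sum_i c_i h_(A_i)^n = 0 implies sum_i c_i Vol(A_i) = 0.  The idea is to compute
    volumes by integrating one coordinate at a time.  Consider the moments
    M_k(A, t, xi), the integrals of (t + <xi, a>)^k over a in A.  Integration along
    the first coordinate ([moment_succ]) writes a moment of degree k as a
    combination of moments of degree k+1 over the projections of the upper and
    lower facets of A.  The coefficients and the new linear form depend on xi and
    on the slope of the facet only; A enters through the constant t.  After n steps
    nothing remains but powers (t + <xi, a>)^(n+k) at vertices a of A, indexed by
    flags of directions that do not depend on A.  The vertices a_i of several A_i
    belonging to the same flag are exposed by one common direction v, and near v
    the function sum_i c_i h_(A_i)^n is the polynomial sum_i c_i <., a_i>^n; so if
    the former vanishes, the latter vanishes at xi ([exposed_power_sum]), and the
    volumes cancel flag by flag.  [moment_vanish] is this argument, by induction on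
    the dimension.

    Two points need care.  Each step divides by the first coordinate of the current
    linear form; this is nonzero in all the finitely many steps when xi is far out
    on the moment curve (1, s, s^2, ...), and degree 0 moments do not depend on xi.
    And the facets must be finite in number and cover the boundary: Fourier-Motzkin
    elimination shows that a convex hull of finitely many points is an intersection
    of half-spaces ([hull_halfspaces]), and those that are not vertical provide the
    finite list of slopes ([facet_slopes]).  This also makes hulls measurable.
    Facets of different slopes overlap over hyperplanes only, which are null sets. *)

(** * Splitting off the first coordinate *)

Section Coordinates.
Variable R : realType.
Implicit Types n : nat.

Lemma pairingE n (v : 'rV[R]_n) (a : 'cV[R]_n) :
  pairing v a = \sum_i v 0 i * a i 0.
Proof. by rewrite /pairing mxE. Qed.

Lemma pairingDl n (v w : 'rV[R]_n) (a : 'cV[R]_n) :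
  pairing (v + w) a = pairing v a + pairing w a.
Proof. by rewrite /pairing mulmxDl mxE. Qed.

Lemma pairingZl n (c : R) (v : 'rV[R]_n) (a : 'cV[R]_n) :
  pairing (c *: v) a = c * pairing v a.
Proof. by rewrite /pairing -scalemxAl mxE. Qed.

Definition chead n (a : 'cV[R]_n.+1) : R := a ord0 0.
Definition ctail n (a : 'cV[R]_n.+1) : 'cV[R]_n := \col_i a (lift ord0 i) 0.
Definition ccons n (x : R) (y : 'cV[R]_n) : 'cV[R]_n.+1 :=
  \col_i oapp (fun j => y j 0) x (unlift ord0 i).
Definition rowcons n (x : R) (w : 'rV[R]_n) : 'rV[R]_n.+1 :=
  \row_i oapp (fun j => w 0 j) x (unlift ord0 i).
Definition rhead n (v : 'rV[R]_n.+1) : R := v 0 ord0.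
Definition rtail n (v : 'rV[R]_n.+1) : 'rV[R]_n := \row_i v 0 (lift ord0 i).

Lemma ccons_head n x (y : 'cV[R]_n) : chead (ccons x y) = x.
Proof. by rewrite /chead mxE unlift_none. Qed.

Lemma ccons_tail n x (y : 'cV[R]_n) : ctail (ccons x y) = y.
Proof. by apply/colP => i; rewrite !mxE liftK. Qed.

Lemma cconsK n (a : 'cV[R]_n.+1) : ccons (chead a) (ctail a) = a.
Proof. by apply/colP => i; rewrite mxE; case: unliftP => [j ->|->] //=; rewrite mxE. Qed.

Lemma rowconsK n (v : 'rV[R]_n.+1) : rowcons (rhead v) (rtail v) = v.
Proof. by apply/rowP => i; rewrite mxE; case: unliftP => [j ->|->] //=; rewrite mxE. Qed.

Lemma pairing_split n (v : 'rV[R]_n.+1) (a : 'cV[R]_n.+1) :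
  pairing v a = rhead v * chead a + pairing (rtail v) (ctail a).
Proof.
by rewrite !pairingE big_ord_recl; congr (_ + _); apply: eq_bigr => i _; rewrite !mxE.
Qed.

Lemma pairing_rowcons n x (w : 'rV[R]_n) (a : 'cV[R]_n.+1) :
  pairing (rowcons x w) a = x * chead a + pairing w (ctail a).
Proof.
rewrite pairing_split /rhead mxE unlift_none /=; congr (_ + pairing _ _).
by apply/rowP => i; rewrite !mxE liftK.
Qed.

Lemma ctail_is_linear n : linear (@ctail n).
Proof. by move=> c a b; apply/colP => i; rewrite !mxE. Qed.

HB.instance Definition _ n :=
  GRing.isLinear.Build R 'cV[R]_n.+1 'cV[R]_n *:%R (@ctail n) (@ctail_is_linear n).

Lemma chead_is_linear n : linear (@chead n : 'cV[R]_n.+1 -> R^o).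
Proof. by move=> c a b; rewrite /chead !mxE. Qed.

HB.instance Definition _ n :=
  GRing.isLinear.Build R 'cV[R]_n.+1 R^o *:%R (@chead n) (@chead_is_linear n).

End Coordinates.

(** * Convex hulls of finite sequences of points *)

Section Hull.
Variable R : realType.
Implicit Types n : nat.

Definition hull n (X : seq 'cV[R]_n) : set 'cV[R]_n :=
  convex_hull [set x | x \in X].

Lemma mem_hull n (X : seq 'cV[R]_n) a : a \in X -> hull X a.
Proof. by move=> aX; exact: sub_convex_hull. Qed.

Lemma hull_neq0 n (X : seq 'cV[R]_n) x : hull X x -> X != [::].
Proof.
move=> [k [a [w [aX w0 w1 _]]]].
case: k a w aX w0 w1 => [|k] a w aX w0 w1.
  by move: w1; rewrite big_ord0 => /eqP; rewrite eq_sym oner_eq0.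
by apply/eqP => X0; have := aX ord0; rewrite X0.
Qed.

(** Adding up the weights that a convex combination gives to equal points makes
    the number of weights independent of the combination, which is what the
    elimination of the weights in [hull_halfspaces] starts from. *)
Lemma hull_weightsP n (X : seq 'cV[R]_n) x : hull X x <->
  exists w : nat -> R, [/\ forall i, (i < size X)%N -> 0 <= w i,
    \sum_(i < size X) w i = 1 & x = \sum_(i < size X) w i *: X`_i].
Proof.
split=> [[k [a [w [aX w0 w1 ->]]]]|[w [w0 w1 ->]]]; last first.
  exists (size X), (fun i => X`_i), w; split => // [i|i]; last exact: w0.
  by rewrite /= mem_nth.
have aX' i : a i \in X by exact: aX.
pose f i : 'I_(size X) := Ordinal (etrans (index_mem (a i) X) (aX' i)).
exists (fun j => \sum_(i | f i == j :> nat) w i); split.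
- by move=> j _; apply: sumr_ge0 => i _.
- by rewrite -w1 (partition_big f xpredT).
- rewrite (partition_big f xpredT) //=; apply: eq_bigr => j _.
  rewrite scaler_suml; apply: eq_bigr => i /eqP <-.
  by rewrite /= nth_index.
Qed.

Lemma seq_argmin (T : eqType) (f : T -> R) (s : seq T) : s != [::] ->
  exists2 a, a \in s & forall b, b \in s -> f a <= f b.
Proof.
elim: s => // a [|b s] IHs _.
  by exists a; rewrite ?mem_head // => b; rewrite inE => /eqP ->.
have [//|c cs cmin] := IHs.
have [ac|ca] := leP (f a) (f c).
  exists a; rewrite ?mem_head // => d; rewrite inE => /predU1P[-> //|/cmin].
  exact: le_trans.
exists c; first by rewrite inE cs orbT.
by move=> d; rewrite inE => /predU1P[->|/cmin //]; exact: ltW.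
Qed.

Lemma support_hullP n (X : seq 'cV[R]_n) (u : 'rV[R]_n) : X != [::] ->
  (exists2 a, a \in X & Defs.support (hull X) u = pairing u a) /\
  forall x, hull X x -> pairing u x <= Defs.support (hull X) u.
Proof.
move=> X0; have [a aX amin] := seq_argmin (fun a => - pairing u a) X0.
have amax b : b \in X -> pairing u b <= pairing u a.
  by move=> /amin; rewrite lerN2.
have hmax := support_hull (X := [set x | x \in X]) aX amax.
have sE : Defs.support (hull X) u = pairing u a.
  by apply: (@Defs.supportE _ _ (hull X)) => //; exact: mem_hull.
by split=> [|x /hmax]; [exists a|rewrite sE].
Qed.

(** The face of the hull in a direction is spanned by the points in that face:
    the others have to carry the weight zero. *)
Lemma hull_face n (X : seq 'cV[R]_n) (u : 'rV[R]_n) (M : R) x :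
  (forall a, a \in X -> pairing u a <= M) -> hull X x -> pairing u x = M ->
  hull [seq a <- X | pairing u a == M] x.
Proof.
move=> XM [k [a [w [aX w0 w1 ->]]]] uM.
have dw i : w i != 0 -> pairing u (a i) == M.
  have /eqP : \sum_i w i * (M - pairing u (a i)) = 0.
    under eq_bigr do rewrite mulrBr.
    by rewrite sumrB -mulr_suml w1 mul1r -uM pairing_sum subrr.
  rewrite psumr_eq0 => [/allP/(_ i)|j _]; last first.
    by rewrite mulr_ge0 // subr_ge0; exact/XM/aX.
  rewrite mem_index_enum mulf_eq0 => /(_ isT) /orP[-> //|].
  by rewrite subr_eq0 eq_sym.
have [i0 wi0] : exists i, w i != 0.
  apply: contrapT => w00; have := w1; rewrite big1 => [|i _].
    by move/eqP; rewrite eq_sym oner_eq0.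
  by apply/eqP; apply: contrapT => wi; apply: w00; exists i; apply/negP.
exists k, (fun i => if w i == 0 then a i0 else a i), w; split => //.
  move=> i /=; rewrite mem_filter; case: ifPn => [_|/dw ->]; last exact: aX.
  by rewrite dw //=; exact: aX.
by apply: eq_bigr => i _; case: eqP => [->|//]; rewrite !scale0r.
Qed.

Lemma hull_map n m (f : {linear 'cV[R]_n -> 'cV[R]_m}) (X : seq 'cV[R]_n) x :
  hull X x -> hull (map f X) (f x).
Proof.
move=> [k [a [w [aX w0 w1 ->]]]].
exists k, (f \o a), w; split => //; first by move=> i /=; apply/map_f/aX.
by rewrite linear_sum; apply: eq_bigr => i _; rewrite linearZ_LR.
Qed.

End Hull.

(** * Fourier-Motzkin elimination *)

Section FourierMotzkin.
Variable R : realType.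

Lemma between_seq (L U : seq R) :
  (forall l u, l \in L -> u \in U -> l <= u) ->
  exists z, (forall l, l \in L -> l <= z) /\ (forall u, u \in U -> z <= u).
Proof.
elim: L => [_|l L IHL LU].
  elim: U => [|u U [z [_ zU]]]; first by exists 0.
  exists (Num.min u z); split=> // v; rewrite inE => /predU1P[->|/zU vz].
    by rewrite ge_min lexx.
  by rewrite ge_min vz orbT.
have [|z [Lz zU]] := IHL.
  by move=> l' u l'L; apply: LU; rewrite inE l'L orbT.
exists (Num.max l z); split=> [l'|u uU].
  rewrite inE => /predU1P[->|/Lz zl]; first by rewrite le_max lexx.
  by rewrite le_max zl orbT.
by rewrite ge_max LU ?mem_head //= zU.
Qed.

(** The inequalities with a positive coefficient bound z from below and those with
    a negative one from above; a solution exists when every lower bound is at most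
    every upper bound. *)
Lemma eliminate_unknown (T : eqType) (s : seq T) (al e : T -> R) :
  (exists z, forall c, c \in s -> 0 <= al c * z + e c) <->
  (forall c, c \in s -> al c = 0 -> 0 <= e c) /\
  (forall p q, p \in s -> q \in s -> 0 < al p -> al q < 0 ->
     0 <= al p * e q - al q * e p).
Proof.
split=> [[z zs]|[s0 spq]].
  split=> [c /zs + c0|p q /zs hp /zs hq p0 q0]; first by rewrite c0 mul0r add0r.
  have := ler_wpM2l (ltW p0) hq.
  have q0' : 0 <= - al q by rewrite oppr_ge0 ltW.
  have := ler_wpM2l q0' hp; rewrite !mulr0; nra.
have [|z [zL zU]] := @between_seq [seq - (al p)^-1 * e p | p <- s & 0 < al p]
    [seq - (al q)^-1 * e q | q <- s & al q < 0].
  move=> _ _ /mapP[p + ->] /mapP[q + ->].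
  rewrite !mem_filter => /andP[p0 ps] /andP[q0 qs].
  have := spq _ _ ps qs p0 q0.
  have p00 : al p != 0 by rewrite gt_eqF.
  have q00 : al q != 0 by rewrite lt_eqF.
  rewrite -subr_ge0 => h; rewrite -subr_ge0.
  have -> : - (al q)^-1 * e q - - (al p)^-1 * e p =
    (al p * e q - al q * e p - 0) / (al p * - al q).
    by field; rewrite p00 q00.
  by apply: divr_ge0 => //; rewrite mulr_ge0 ?oppr_ge0 // ltW.
exists z => c cs; case: (ltgtP (al c) 0) => [c0|c0|c0].
- have /zU : - (al c)^-1 * e c \in [seq - (al q)^-1 * e q | q <- s & al q < 0].
    by apply/mapP; exists c => //; rewrite mem_filter c0.
  move=> /(ler_wnM2l (ltW c0)).
  by rewrite mulrA mulrN divff ?lt_eqF // mulN1r; lra.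
- have /zL : - (al c)^-1 * e c \in [seq - (al q)^-1 * e q | q <- s & 0 < al q].
    by apply/mapP; exists c => //; rewrite mem_filter c0.
  move=> /(ler_wpM2l (ltW c0)).
  by rewrite mulrA mulrN divff ?gt_eqF // mulN1r; lra.
- by rewrite c0 mul0r add0r s0.
Qed.

Variable n : nat.

(** ((al, b), c) encodes sum_i al_i w_i + <b, y> + c >= 0, with unknowns w and
    parameter y.  The al_i are indexed by all of nat so that the type does not
    depend on the number of unknowns left. *)
Definition row_ineq : Type := (nat -> R) * 'rV[R]_n * R.

Definition row_value k (w : nat -> R) (y : 'cV[R]_n) (c : row_ineq) : R :=
  \sum_(i < k) c.1.1 i * w i + (pairing c.1.2 y + c.2).

Definition row_comb (p q : R) (c d : row_ineq) : row_ineq :=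
  ((fun i => p * c.1.1 i + q * d.1.1 i, p *: c.1.2 + q *: d.1.2),
   p * c.2 + q * d.2).

Lemma row_value_comb k w y p q c d :
  row_value k w y (row_comb p q c d) =
  p * row_value k w y c + q * row_value k w y d.
Proof.
rewrite /row_value /= pairingDl !pairingZl.
under eq_bigr do rewrite mulrDl -!mulrA.
rewrite big_split /= -!mulr_sumr; ring.
Qed.

Lemma eliminate_unknowns k (s : seq row_ineq) :
  exists s' : seq ('rV[R]_n * R), forall y,
    (exists w, forall c, c \in (s : seq row_ineq) -> 0 <= row_value k w y c) <->
    (forall c, c \in s' -> 0 <= pairing c.1 y + c.2).
Proof.
elim: k s => [|k IHk] s.
  exists [seq (c.1.2, c.2) | c <- s] => y; split=> [[w ws] _ /mapP[c cs ->]|h].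
    by have := ws c cs; rewrite /row_value big_ord0 add0r.
  exists (fun=> 0) => c cs; rewrite /row_value big_ord0 add0r.
  exact: (h _ (map_f _ cs)).
pose t := [seq c <- s | c.1.1 k == 0] ++
  [seq row_comb (p.1.1 k) (- q.1.1 k) q p | p <- [seq p <- s | 0 < p.1.1 k],
                                             q <- [seq q <- s | q.1.1 k < 0]].
have [s' s'P] := IHk t; exists s' => y; rewrite -s'P {s'P}.
have elim1 w : (exists z, forall c, c \in s ->
      0 <= c.1.1 k * z + row_value k w y c) <->
    (forall c, c \in t -> 0 <= row_value k w y c).
  rewrite eliminate_unknown; split=> [[s0 spq] c|h].
    rewrite mem_cat => /orP[|/allpairsP[[p q] /= []]].
      by rewrite mem_filter => /andP[/eqP c0 cs]; exact: s0.
    rewrite !mem_filter => /andP[p0 ps] /andP[q0 qs] ->.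
    by rewrite row_value_comb mulNr; exact: spq.
  split=> [c cs c0|p q ps qs p0 q0].
    by apply: h; rewrite mem_cat mem_filter c0 eqxx cs.
  rewrite -mulNr -row_value_comb; apply: h; rewrite mem_cat; apply/orP; right.
  apply/allpairsP; exists (p, q); rewrite /= !mem_filter p0 q0 ps qs.
  by split.
split=> [[w ws]|[w /elim1[z zs]]].
  exists w; apply/elim1; exists (w k) => c cs.
  by have := ws c cs; rewrite /row_value big_ord_recr /= -addrA addrCA.
exists (fun i => if i == k then z else w i) => c cs.
rewrite /row_value big_ord_recr /= eqxx -addrA addrCA.
have -> : \sum_(i < k) c.1.1 i * (if i == k :> nat then z else w i) =
          \sum_(i < k) c.1.1 i * w i.
  by apply: eq_bigr => i _; rewrite ltn_eqF.
exact: zs.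
Qed.

(** The weights of a convex combination are solutions of linear inequalities that
    have the point as a parameter; eliminating them leaves inequalities for the
    point. *)
Lemma hull_halfspaces (X : seq 'cV[R]_n) :
  exists s : seq ('rV[R]_n * R), forall x,
    hull X x <-> (forall c, c \in s -> 0 <= pairing c.1 x + c.2).
Proof.
set k := size X.
pose nonneg j : row_ineq := ((fun i => (i == j)%:R, 0), 0).
(* An equation is a pair of opposite inequalities, told apart by a boolean. *)
pose total (b : bool) : row_ineq := ((fun=> (-1) ^+ b, 0), - (-1) ^+ b).
pose coord (jb : 'I_n * bool) : row_ineq :=
  ((fun i => (-1) ^+ jb.2 * X`_i jb.1 0, - (-1) ^+ jb.2 *: delta_mx 0 jb.1), 0).
pose s : seq row_ineq := [seq nonneg j | j <- iota 0 k] ++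
  [seq total b | b <- [:: true; false]] ++
  [seq coord (j, b) | j <- enum 'I_n, b <- [:: true; false]].
have [s' s'P] := eliminate_unknowns k s; exists s' => x; rewrite -s'P {s'P}.
have vnonneg w j : (j < k)%N -> row_value k w x (nonneg j) = w j.
  move=> jk; rewrite /row_value /= addr0 /pairing mul0mx mxE addr0.
  rewrite (bigD1 (Ordinal jk)) //= eqxx mul1r big1 ?addr0 // => i ij.
  by rewrite (_ : (i : nat) == j = false) ?mul0r //; apply/negbTE.
have vtotal w b : row_value k w x (total b) =
    (-1) ^+ b * (\sum_(i < k) w i - 1).
  rewrite /row_value /= /pairing mul0mx mxE add0r -mulr_sumr; ring.
have vcoord w j b : row_value k w x (coord (j, b)) =
    (-1) ^+ b * ((\sum_(i < k) w i *: X`_i) j 0 - x j 0).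
  rewrite /row_value /= addr0 pairingZl.
  have -> : pairing (delta_mx 0 j) x = x j 0.
    by rewrite /pairing -rowE mxE.
  under eq_bigr do rewrite -mulrA.
  rewrite -mulr_sumr summxE mulrBr mulNr; congr (_ * _ - _).
  by apply: eq_bigr => i _; rewrite mxE mulrC.
have sgn (z : R) : (forall b : bool, 0 <= (-1) ^+ b * z) -> z = 0.
  move=> h; have := h true; have := h false; rewrite expr0 expr1; lra.
rewrite hull_weightsP; split=> [[w [w0 w1 xE]]|[w ws]]; exists w.
  move=> c; rewrite !mem_cat => /or3P[/mapP[j]|/mapP[b _ ->]|/allpairsP[[j b] [_ _ ->]]].
  - by rewrite mem_iota add0n /= => jk ->; rewrite vnonneg // w0.
  - by rewrite vtotal w1 subrr mulr0.
  - by rewrite vcoord -xE subrr mulr0.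
split.
- move=> i ik; rewrite -vnonneg //; apply: ws; rewrite mem_cat map_f //.
  by rewrite mem_iota.
- apply/eqP; rewrite -subr_eq0; apply/eqP/sgn => b; rewrite -vtotal; apply: ws.
  by rewrite !mem_cat (map_f total) ?orbT //; case: b.
- apply/colP => j; apply/eqP; rewrite eq_sym -subr_eq0; apply/eqP/sgn => b.
  rewrite -vcoord; apply: ws; rewrite !mem_cat; apply/or3P/Or33.
  by apply/allpairsP; exists (j, b); rewrite mem_enum; split=> //; case: b.
Qed.

End FourierMotzkin.

(** * Upper and lower facets *)

Section Facets.
Variables (R : realType) (n : nat).
Implicit Types (X : seq 'cV[R]_n.+1) (g : 'rV[R]_n) (sg : R).

(** With sg = 1 this exposes upper facets, and with sg = -1 lower ones: the facet
    is the graph of x_1 = [facet_offset sg g X] + <g, y> over its projection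
    [facet sg g X]. *)
Definition slope_dir sg g : 'rV[R]_n.+1 := rowcons sg (- sg *: g).

Definition facet_offset sg g X : R :=
  sg * Defs.support (hull X) (slope_dir sg g).

Definition facet sg g X : seq 'cV[R]_n :=
  [seq ctail a | a <- X &
    pairing (slope_dir sg g) a == Defs.support (hull X) (slope_dir sg g)].

Lemma pairing_slope_dir sg g (a : 'cV[R]_n.+1) :
  pairing (slope_dir sg g) a = sg * (chead a - pairing g (ctail a)).
Proof. by rewrite pairing_rowcons pairingZl; ring. Qed.

Lemma slope_dir_supportP sg g X (a : 'cV[R]_n.+1) : sg * sg = 1 ->
  pairing (slope_dir sg g) a = Defs.support (hull X) (slope_dir sg g) <->
  chead a = facet_offset sg g X + pairing g (ctail a).
Proof.
move=> sg2; rewrite pairing_slope_dir /facet_offset; split=> [<-|->].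
  by rewrite mulrA sg2; ring.
by rewrite addrK mulrA sg2 mul1r.
Qed.

Lemma facet_neq0 sg g X : X != [::] -> facet sg g X != [::].
Proof.
move=> /(support_hullP (slope_dir sg g))[[a aX aE] _].
have : ctail a \in facet sg g X.
  by apply: map_f; rewrite mem_filter aE eqxx.
by case: (facet sg g X).
Qed.

Lemma mem_facet sg g X y : sg * sg = 1 -> y \in facet sg g X ->
  ccons (facet_offset sg g X + pairing g y) y \in X.
Proof.
move=> sg2 /mapP[a]; rewrite mem_filter => /andP[/eqP /(slope_dir_supportP _ _ _ sg2) ha aX] ->.
by rewrite -ha cconsK.
Qed.

Lemma hull_facetP sg g X y : sg * sg = 1 -> X != [::] ->
  hull (facet sg g X) y <->
  hull X (ccons (facet_offset sg g X + pairing g y) y).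
Proof.
move=> sg2 X0; split=> [[k [a [w [aX w0 w1 ->]]]]|hy].
  exists k, (fun i => ccons (facet_offset sg g X + pairing g (a i)) (a i)), w.
  split=> // [i|]; first by apply: mem_facet => //; exact: aX.
  rewrite -[RHS]cconsK; congr ccons; last first.
    by rewrite linear_sum; apply: eq_bigr => i _; rewrite linearZ_LR /= ccons_tail.
  rewrite /chead summxE pairing_sum -[X in X + _ = _]mul1r -w1 mulr_suml.
  rewrite -big_split; apply: eq_bigr => i _.
  by rewrite mxE mxE unlift_none /= mulrDr.
have [_ umax] := support_hullP (slope_dir sg g) X0.
have hE : pairing (slope_dir sg g) (ccons (facet_offset sg g X + pairing g y) y) =
    Defs.support (hull X) (slope_dir sg g).
  by apply/slope_dir_supportP => //; rewrite ccons_head ccons_tail.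
have := hull_face (fun a aX => umax a (mem_hull aX)) hy hE.
by move=> /(hull_map (@ctail R n)); rewrite /= ccons_tail.
Qed.

Lemma hull_le_facet sg g X a : sg * sg = 1 -> hull X a ->
  sg * chead a <= sg * (facet_offset sg g X + pairing g (ctail a)).
Proof.
move=> sg2 Xa; have [_ /(_ _ Xa)] := support_hullP (slope_dir sg g) (hull_neq0 Xa).
by rewrite pairing_slope_dir /facet_offset !mulrDr mulrA sg2 mul1r mulrN; lra.
Qed.

(** The half-spaces that cut out the hull and are not vertical provide the slopes:
    the highest (or lowest) point of the fibre over y is where the tightest of
    their inequalities becomes an equality. *)
Lemma facet_slopes X : exists G : seq 'rV[R]_n,
  forall sg x y, sg * sg = 1 -> hull X (ccons x y) ->
    exists2 g, g \in G & hull (facet sg g X) y.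
Proof.
have [s sP] := hull_halfspaces X.
exists [seq - (rhead c.1)^-1 *: rtail c.1 | c <- s] => sg x y sg2 Xxy.
have X0 := hull_neq0 Xxy.
have sg0 : sg != 0 by apply/eqP => sg0; move: sg2; rewrite sg0 mul0r => /eqP;
  rewrite eq_sym oner_eq0.
(* On the fibre over y, the inequality c says that sg * z <= b c if it bounds in
   the direction sg, that is, if it belongs to t. *)
pose b (c : 'rV[R]_n.+1 * R) := - (pairing (rtail c.1) y + c.2) / (sg * rhead c.1).
pose t := [seq c <- s | sg * rhead c.1 < 0].
have cval c z : pairing c.1 (ccons z y) + c.2 =
    sg * rhead c.1 * (sg * z) + (pairing (rtail c.1) y + c.2).
  rewrite pairing_split ccons_head ccons_tail.
  by rewrite mulrACA sg2 mul1r addrA.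
have below c z : c \in t -> (0 <= pairing c.1 (ccons z y) + c.2) = (sg * z <= b c).
  rewrite mem_filter => /andP[c0 _]; rewrite cval /b.
  by rewrite ler_ndivlMr // -[RHS]subr_ge0 opprK [sg * z * _]mulrC.
have xs c : c \in s -> 0 <= pairing c.1 (ccons x y) + c.2.
  by move: c; exact: (sP _).1.
have inc c z : c \in s -> c \notin t -> sg * x <= sg * z ->
    0 <= pairing c.1 (ccons z y) + c.2.
  move=> cs; rewrite mem_filter cs andbT -leNgt => c0 xz.
  have := xs c cs; rewrite !cval => h; apply: le_trans h _.
  by rewrite lerD2r ler_wpM2l.
(* Without such an inequality the hull would be unbounded in the direction sg. *)
have t0 : t != [::].
  apply/eqP => t0.
  have [_ umax] := support_hullP (slope_dir sg 0) X0.
  set M := Defs.support _ _ in umax.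
  have : hull X (ccons (sg * (`|M| + sg * x + 1 + `|sg * x|)) y).
    apply/sP => c cs; apply: inc => //; first by rewrite t0.
    rewrite mulrA sg2 mul1r; have := normr_ge0 M; have := normr_ge0 (sg * x).
    lra.
  move=> /umax; rewrite pairing_slope_dir ccons_head ccons_tail.
  rewrite /pairing mul0mx mxE subr0 mulrA sg2 mul1r.
  have := ler_norm M; have := ler_norm (- (sg * x)); rewrite normrN; lra.
have [c ct cmin] := seq_argmin b t0.
have [c0 cs] : sg * rhead c.1 < 0 /\ c \in s.
  by move: ct; rewrite mem_filter => /andP.
have r0 : rhead c.1 != 0.
  by apply: contraTneq c0 => ->; rewrite mulr0 ltxx.
have Xc : hull X (ccons (sg * b c) y).
  apply/sP => d ds; have [dt|dt] := boolP (d \in t).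
    by rewrite below // mulrA sg2 mul1r cmin.
  by apply: inc => //; rewrite mulrA sg2 mul1r -below // xs.
pose g := - (rhead c.1)^-1 *: rtail c.1.
have slopeE a : pairing (slope_dir sg g) a =
    sg * c.2 / - rhead c.1 + (sg / rhead c.1) * (pairing c.1 a + c.2).
  by rewrite pairing_slope_dir pairing_split pairingZl; field.
exists g; first exact: map_f.
apply/hull_facetP => //.
suff -> : facet_offset sg g X + pairing g y = sg * b c by [].
have bE : pairing c.1 (ccons (sg * b c) y) + c.2 = 0.
  rewrite cval [sg * (sg * _)]mulrA sg2 mul1r /b; field.
  by rewrite sg0 r0.
have supE : Defs.support (hull X) (slope_dir sg g) = sg * c.2 / - rhead c.1.
  have -> : sg * c.2 / - rhead c.1 = pairing (slope_dir sg g) (ccons (sg * b c) y).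
    by rewrite slopeE bE mulr0 addr0.
  apply: Defs.supportE => // a Xa; rewrite !slopeE bE mulr0 addr0.
  rewrite gerDl; apply: mulr_le0_ge0; last exact: (sP a).1.
  have -> : sg / rhead c.1 = (sg * rhead c.1) / (rhead c.1 ^+ 2).
    by field.
  by rewrite mulr_le0_ge0 ?invr_ge0 ?sqr_ge0 // ltW.
rewrite /facet_offset supE -mulrA [sg * (sg * _)]mulrA sg2 pairingZl /b; field.
by rewrite sg0 r0.
Qed.

End Facets.

(** * Lebesgue measure on tuples *)

Section TupleMeasure.
Variable R : realType.
Local Notation leb := (@lebesgue_measure R).
Local Notation tupleR n := (n.-tuple (measurableTypeR R)).

Definition consp n (p : measurableTypeR R * tupleR n) : tupleR n.+1 :=
  [tuple of p.1 :: p.2].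

Definition unconsp n (t : tupleR n.+1) : measurableTypeR R * tupleR n :=
  (thead t, [tuple of behead t]).

Lemma conspK n : cancel (@consp n) (@unconsp n).
Proof. by move=> [x t]; congr pair; apply: val_inj. Qed.

Lemma measurable_consp n : measurable_fun setT (@consp n).
Proof. by apply: measurable_cons; [exact: measurable_fst|exact: measurable_snd]. Qed.

Lemma measurable_unconsp n : measurable_fun setT (@unconsp n).
Proof.
apply: measurable_fun_pair; last exact: measurable_behead.
exact: (measurable_tnth ord0).
Qed.

(** One step of [lebesgue_tuple], isolated so that it can carry the structure of a
    sigma-finite measure. *)
Definition cons_measure n (m : set (tupleR n) -> \bar R) :
  set (tupleR n.+1) -> \bar R := pushforward (leb \x m)%E (@consp n).

Section Instances.
Variables (n : nat) (m : {sigma_finite_measure set (tupleR n) -> \bar R}).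

Let cons_measure0 : cons_measure m set0 = 0%E.
Proof. by rewrite /cons_measure /pushforward preimage_set0 measure0. Qed.

Let cons_measure_ge0 A : (0 <= cons_measure m A)%E.
Proof. exact: (@measure_ge0 _ _ _ (leb \x m)%E). Qed.

Let cons_measure_sigma_additive : semi_sigma_additive (cons_measure m).
Proof.
exact: (@measure_semi_sigma_additive _ _ _
  (measure_function_pushforward__canonical__measure_function_Measure
    (leb \x m)%E (@measurable_consp n))).
Qed.

HB.instance Definition _ := isMeasure.Build _ _ _ (cons_measure m)
  cons_measure0 cons_measure_ge0 cons_measure_sigma_additive.

Let cons_measure_sigma_finite : sigma_finite setT (cons_measure m).
Proof.
have /sigma_finiteP[F [UF ndF Foo]] := sigma_finiteT leb.
have /sigma_finiteP[G [UG ndG Goo]] := sigma_finiteT m.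
exists (fun k => @unconsp n @^-1` (F k `*` G k)).
  rewrite -preimage_bigcup; apply/esym/seteqP; split=> // t _.
  have [i _ Fi] : (\bigcup_k F k) (unconsp t).1 by rewrite -UF.
  have [j _ Gj] : (\bigcup_k G k) (unconsp t).2 by rewrite -UG.
  exists (maxn i j) => //; split.
    by move: Fi; exact/subsetPset/ndF/leq_maxl.
  by move: Gj; exact/subsetPset/ndG/leq_maxr.
move=> k; have [mF Fk] := Foo k; have [mG Gk] := Goo k.
have mFG : measurable (F k `*` G k) by exact: measurableX.
split; first by rewrite -[X in measurable X]setTI; exact: measurable_unconsp.
rewrite /cons_measure /pushforward (_ : _ @^-1` _ = F k `*` G k).
  by rewrite product_measure1E// lte_mul_pinfty// ge0_fin_numE.
by apply/funext => p; rewrite /preimage /mkset conspK.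
Qed.

HB.instance Definition _ := Measure_isSigmaFinite.Build _ _ _ (cons_measure m)
  cons_measure_sigma_finite.

End Instances.

Fixpoint tuple_measure n : {sigma_finite_measure set (tupleR n) -> \bar R} :=
  match n with
  | 0 => \d_([tuple])
  | m.+1 => cons_measure (tuple_measure m)
  end.

Lemma tuple_measureE n : tuple_measure n = @lebesgue_tuple R n :> (set _ -> \bar R).
Proof. by elim: n => //= n <-. Qed.

End TupleMeasure.

Section PolytopeMeasure.
Variable R : realType.
Local Notation leb := (@lebesgue_measure R).
Local Notation tupleR n := (n.-tuple (measurableTypeR R)).
Local Notation mu := (@tuple_measure R _).

Definition colt n (t : tupleR n) : 'cV[R]_n := \col_i tnth t i.

Lemma colt_consp n (p : measurableTypeR R * tupleR n) :
  colt (consp p) = ccons p.1 (colt p.2).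
Proof.
apply/colP => i; rewrite !mxE; case: unliftP => [j ->|->] /=.
  by rewrite mxE tnthS.
by rewrite tnth0.
Qed.

Lemma measurable_pairing n (b : 'rV[R]_n) :
  measurable_fun setT (fun t : tupleR n => pairing b (colt t)).
Proof.
under eq_fun do rewrite pairingE.
apply: measurable_sum => i; apply: measurable_funM; first exact: measurable_cst.
by under eq_fun do rewrite mxE; exact: measurable_tnth.
Qed.

Lemma measurable_hull n (X : seq 'cV[R]_n) :
  measurable [set t : tupleR n | hull X (colt t)].
Proof.
have [s sP] := hull_halfspaces X.
rewrite (_ : [set _ | _] =
    [set t | forall c, c \in s -> 0 <= pairing c.1 (colt t) + c.2]); last first.
  by apply/seteqP; split=> t /sP.
elim: s {sP} => [|c s IHs].
  by rewrite (_ : [set _ | _] = setT) //; apply/seteqP; split.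
rewrite (_ : [set _ | _] = (fun t => pairing c.1 (colt t) + c.2) @^-1` `[0, +oo[ `&`
    [set t | forall c, c \in s -> 0 <= pairing c.1 (colt t) + c.2]).
  apply: measurableI => //; rewrite -[X in measurable X]setTI.
  have mf : measurable_fun setT (fun t : tupleR n => pairing c.1 (colt t) + c.2).
    by apply: measurable_funD => //; exact: measurable_pairing.
  by apply: mf => //; exact: measurable_itv.
apply/seteqP; split=> [t h|t [h1 h2] d] /=.
  split; first by rewrite /preimage /= in_itv /= andbT h ?mem_head.
  by move=> d ds; apply: h; rewrite inE ds orbT.
rewrite inE => /predU1P[->|/h2 //].
by move: h1; rewrite /preimage /= in_itv /= andbT.
Qed.

Lemma measurable_hyperplane n (b : 'rV[R]_n) c :
  measurable [set t : tupleR n | pairing b (colt t) = c].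
Proof.
rewrite (_ : [set _ | _] = (fun t => pairing b (colt t)) @^-1` [set c]) //.
by rewrite -[X in measurable X]setTI; apply: measurable_pairing.
Qed.

(** By induction on the dimension: if b has a nonzero coordinate other than the
    first, every section with fixed first coordinate is a hyperplane of one
    dimension less; otherwise the first coordinate is constant. *)
Lemma hyperplane_null n (b : 'rV[R]_n) c : b != 0 ->
  mu [set t : tupleR n | pairing b (colt t) = c] = 0%E.
Proof.
elim: n b c => [b c|n IHn b c b0]; first by rewrite thinmx0 eqxx.
pose A := [set p : measurableTypeR R * tupleR n |
  rhead b * p.1 + pairing (rtail b) (colt p.2) = c].
have AE : @consp R n @^-1` [set t | pairing b (colt t) = c] = A.
  apply/seteqP; split=> p /=;
  by rewrite colt_consp pairing_split ccons_head ccons_tail.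
have mA : measurable A.
  by rewrite -AE -[X in measurable X]setTI; apply: measurable_consp => //;
    exact: measurable_hyperplane.
change ((leb \x mu)%E (@consp R n @^-1` [set t | pairing b (colt t) = c]) = 0%E).
rewrite AE; have [b10|b10] := eqVneq (rtail b) 0.
  have b00 : rhead b != 0.
    apply: contraNneq b0 => b00; rewrite -[b]rowconsK b00 b10; apply/eqP/rowP => i.
    by rewrite !mxE; case: unliftP => [j _|_] /=; rewrite ?mxE.
  apply: (@subset_measure0 _ _ _ ((leb \x mu)%E : {measure set _ -> \bar R})
    _ ([set c / rhead b] `*` setT)) => //.
  - exact: measurableX.
  - move=> [x y]; rewrite /A /= b10 /pairing mul0mx mxE addr0 => <-; split=> //=.
    by rewrite mulrC mulKf.
  - apply: (etrans (product_measure1E leb mu (measurable_set1 _) measurableT)).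
    by rewrite [X in (X * _)%E]lebesgue_measure_set1 mul0e.
rewrite /product_measure1 integral0_eq // => x _.
rewrite /= -(IHn (rtail b) (c - rhead b * x) b10); congr (mu _).
apply/seteqP; split=> y; rewrite /xsection /= inE /A /=; lra.
Qed.

(** The support function bounds the coordinates, so a hull lies in a box. *)
Lemma hull_finite_measure n (X : seq 'cV[R]_n) :
  (mu [set t : tupleR n | hull X (colt t)] < +oo)%E.
Proof.
pose box n M := [set t : tupleR n | forall i, tnth t i \in `[- M, M]].
have mbox k M : measurable (box k M).
  rewrite (_ : box k M = \bigcap_(i in [set: 'I_k])
      (fun t : tupleR k => tnth t i) @^-1` `[- M, M]); last first.
    by apply/seteqP; split=> [t h i _|t h i]; exact: h.
  apply: fin_bigcap_measurable => // i _; rewrite -[X in measurable X]setTI.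
  exact: (measurable_tnth i measurableT (measurable_itv _)).
have box_fin k M : (mu (box k M) < +oo)%E.
  elim: k => [|k IHk]; first by rewrite /= diracE ltry.
  change ((leb \x mu)%E (@consp R k @^-1` box k.+1 M) < +oo)%E.
  rewrite (_ : _ @^-1` _ = `[- M, M]%classic `*` box k M).
    rewrite (product_measure1E leb mu (measurable_itv _) (mbox k M)).
    have leb_fin : let I := `[- M, M]%classic in (leb I < +oo)%E.
      rewrite /= lebesgue_measure_itv; case: ifP => _; last exact: ltry.
      by rewrite -EFinB ltry.
    by apply: lte_mul_pinfty => //; rewrite ge0_fin_numE.
  apply/seteqP; split=> [p h|p [h1 h2] i].
    split=> [|i]; first by have := h ord0; rewrite tnth0.
    by have := h (lift ord0 i); rewrite tnthS.
  by case: (unliftP ord0 i) => [j ->|->]; rewrite ?tnthS ?tnth0.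
have [->|X0] := eqVneq X [::].
  rewrite (_ : [set _ | _] = set0) ?measure0 ?ltry //.
  by apply/seteqP; split=> // t /= /hull_neq0.
pose h u := Defs.support (hull X) u.
pose M := \sum_i (`|h (delta_mx 0 i)| + `|h (- delta_mx 0 i)|).
apply: (le_lt_trans _ (box_fin n M)); apply: le_measure;
  rewrite ?inE; [exact: measurable_hull|exact: mbox|].
move=> t /= Xt i.
have bound u : pairing u (colt t) <= `|h u|.
  by have [_ /(_ _ Xt) /le_trans] := support_hullP u X0; apply; exact: ler_norm.
have tE : tnth t i = pairing (delta_mx 0 i) (colt t).
  by rewrite /pairing -rowE !mxE.
have MP : `|h (delta_mx 0 i)| + `|h (- delta_mx 0 i)| <= M.
  by rewrite /M (bigD1 i) //= lerDl sumr_ge0 // => j _; rewrite addr_ge0.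
have := bound (delta_mx 0 i); have := bound (- delta_mx 0 i).
have -> : pairing (- delta_mx 0 i) (colt t) = - pairing (delta_mx 0 i) (colt t).
  by rewrite -scaleN1r pairingZl mulN1r.
have := normr_ge0 (h (delta_mx 0 i)); have := normr_ge0 (h (- delta_mx 0 i)).
rewrite in_itv /= tE; set a := pairing _ _; move=> *; apply/andP; split; lra.
Qed.

End PolytopeMeasure.

(** * Moments of a hull and their recursion *)

Section Moments.
Variable R : realType.
Local Notation leb := (@lebesgue_measure R).
Local Notation tupleR n := (n.-tuple (measurableTypeR R)).
Local Notation mu := (@tuple_measure R _).

Definition moment_fun n (X : seq 'cV[R]_n) k t (xi : 'rV[R]_n) (a : 'cV[R]_n) : R :=
  \1_(hull X) a * (t + pairing xi a) ^+ k.

Definition moment n (X : seq 'cV[R]_n) k t (xi : 'rV[R]_n) : R :=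
  \int[mu]_y moment_fun X k t xi (colt y).

(** Stated for an arbitrary parametrization c of the points, because the moment is
    also integrated over the product of a line and a space of lower dimension. *)
Lemma integrable_moment_fun d (T : measurableType d) (m : {measure set T -> \bar R})
    n (c : T -> 'cV[R]_n) (X : seq 'cV[R]_n) k t xi :
  measurable_fun setT (fun y => pairing xi (c y)) ->
  measurable [set y | hull X (c y)] -> (m [set y | hull X (c y)] < +oo)%E ->
  m.-integrable setT (fun y => (moment_fun X k t xi (c y))%:E).
Proof.
move=> mxi mX Xfin; pose D := [set y | hull X (c y)].
have : m.-integrable D (EFin \o (fun y => (t + pairing xi (c y)) ^+ k)).
  apply: measurable_bounded_integrable => //.
    apply: measurable_funTS; apply: measurable_funX.
    by apply: measurable_funD => //; exact: measurable_cst.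
  have [XE|X0] := eqVneq X [::].
    by exists 0; split=> // M _ y; rewrite /D /= XE => /hull_neq0.
  pose h u := Defs.support (hull X) u.
  (* The support function in the directions xi and - xi bounds the linear form. *)
  exists ((`|t| + `|h xi| + `|h (- xi)|) ^+ k); split; first exact: num_real.
  move=> M hM y /= Xy; apply: le_trans (ltW hM); rewrite normrX.
  apply: lerXn2r; rewrite ?nnegrE ?addr_ge0 //.
  have bound u : pairing u (c y) <= `|h u|.
    by have [_ /(_ _ Xy) /le_trans] := support_hullP u X0; apply; exact: ler_norm.
  rewrite -addrA; apply: le_trans (ler_normD _ _) _; rewrite lerD2l ler_norml.
  have := bound xi; have := bound (- xi).
  rewrite -scaleN1r pairingZl mulN1r.
  have := normr_ge0 (h xi); have := normr_ge0 (h (-1 *: xi)).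
  move=> *; apply/andP; split; lra.
move=> /(integrable_mkcond _ mX); congr (integrable _ _ _).
apply/funext => y; rewrite patchE /moment_fun indicE.
have -> : (y \in D) = (c y \in hull X) by apply/idP/idP; rewrite !inE.
by case: ifP; rewrite ?mul1r ?mul0r.
Qed.

Lemma integrable_moment n (X : seq 'cV[R]_n) k t xi :
  mu.-integrable setT (fun y => (moment_fun X k t xi (colt y))%:E).
Proof.
apply: integrable_moment_fun; first exact: measurable_pairing.
  exact: measurable_hull.
exact: hull_finite_measure.
Qed.

Lemma Rintegral_sum d (T : measurableType d) (m : {measure set T -> \bar R})
    (I : Type) (s : seq I) (c : I -> R) (f : I -> T -> R) :
  (forall i, m.-integrable setT (EFin \o f i)) ->
  \int[m]_x (\sum_(i <- s) c i * f i x) = \sum_(i <- s) c i * \int[m]_x f i x.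
Proof.
move=> fi; have cfi i : m.-integrable setT (EFin \o (fun x => c i * f i x)).
  exact: integrableZl (fi i).
elim: s => [|i s IHs].
  rewrite big_nil; under eq_Rintegral do rewrite big_nil.
  by rewrite Rintegral_cst // mul0r.
under eq_Rintegral do rewrite big_cons.
rewrite big_cons RintegralD //; first by rewrite IHs RintegralZl.
rewrite (_ : _ \o _ = fun x => (\sum_(j <- s) (c j * f j x)%:E)%E).
  by apply: integrable_sum => // j _; exact: cfi.
by apply/funext => x; rewrite /= sumEFin.
Qed.

Lemma integral_affine_power (s r a b : R) k : r != 0 -> a <= b ->
  (\int[leb]_(x in `[a, b]) ((s + r * x) ^+ k)%:E =
   (((s + r * b) ^+ k.+1 - (s + r * a) ^+ k.+1) / (k.+1%:R * r))%:E)%E.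
Proof.
move=> r0; rewrite le_eqVlt => /predU1P[->|ab].
  by rewrite set_itv1 integral_set1 subrr mul0r.
pose F (x : R) : R := (k.+1%:R * r)^-1 * (s + r * x) ^+ k.+1.
have dF (x : R) : is_derive x (1 : R) F ((s + r * x) ^+ k).
  have dl : is_derive x (1 : R) (fun x => s + r * x) r.
    have -> : (fun x => s + r * x) = (cst s + r *: id :> (R -> R)) by apply/funext.
    have := is_deriveD (is_derive_cst s x (1 : R)) (is_deriveZ r (is_derive_id x (1 : R))).
    by rewrite add0r [_ *: _]mulr1.
  have -> : F = (k.+1%:R * r)^-1 *: ((fun x => s + r * x) ^+ k.+1 : R -> R).
    by apply/funext => z; rewrite /F /= fctE.
  apply: is_derive_eq; rewrite /GRing.scale /=.
  by rewrite mulrAC mulKf // mulf_neq0 // pnatr_eq0.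
rewrite (@continuous_FTC2 _ _ F) //.
- by rewrite -EFinB /F -mulrBr mulrC.
- apply: continuous_subspaceT => x.
  have -> : (fun x => (s + r * x) ^+ k) = ((cst s + r *: id : R -> R) ^+ k).
    by apply/funext => z; rewrite fctE.
  apply: differentiable_continuous; apply/derivable1_diffP.
  by apply: derivableX; apply: derivableD => //; apply: derivableZ.
- have cF x : {for x, continuous F}.
    by apply: differentiable_continuous; apply/derivable1_diffP; case: (dF x).
  split; first by move=> x _; case: (dF x).
    exact/cvg_at_right_filter/cF.
  exact/cvg_at_left_filter/cF.
- by move=> x _; rewrite derive1E; case: (dF x).
Qed.

End Moments.

Lemma near_all_seq (S : Type) (F : set_system S) (FF : Filter F) (T : eqType)
    (s : seq T) (P : T -> S -> Prop) :
  (forall a, a \in s -> \forall x \near F, P a x) ->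
  \forall x \near F, forall a, a \in s -> P a x.
Proof.
elim: s => [_|a s IHs h]; first exact: nearW.
have := IHs (fun b bs => h b (mem_behead (s := a :: s) bs)).
apply: filterS2 (h a (mem_head a s)) => x Pa Ps b.
by rewrite inE => /predU1P[->|/Ps].
Qed.

Section Recursion.
Variable R : realType.
Local Notation leb := (@lebesgue_measure R).
Local Notation tupleR n := (n.-tuple (measurableTypeR R)).
Local Notation mu := (@tuple_measure R _).

Definition signs : seq R := [:: 1; -1].

Lemma signs_sqr (sg : R) : sg \in signs -> sg * sg = 1.
Proof. by rewrite !inE => /orP[] /eqP ->; rewrite ?mulrNN mulr1. Qed.

Definition facet_height n (sg : R) (g : 'rV[R]_n) X (y : 'cV[R]_n) : R :=
  facet_offset sg g X + pairing g y.

(** Both heights are the maximum (or minimum) of the first coordinate over y. *)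
Lemma facet_height_uniq n sg (g g' : 'rV[R]_n) X y : sg \in signs ->
  hull (facet sg g X) y -> hull (facet sg g' X) y ->
  facet_height sg g X y = facet_height sg g' X y.
Proof.
move=> sgs; have sg2 := signs_sqr sgs.
have [->|X0] := eqVneq X [::]; first by move=> /hull_neq0.
move=> /(hull_facetP _ _ sg2 X0) hg /(hull_facetP _ _ sg2 X0) hg'.
have := hull_le_facet g' sg2 hg; have := hull_le_facet g sg2 hg'.
rewrite !ccons_head !ccons_tail -!/(facet_height _ _ _ _).
by move: sgs; rewrite !inE => /orP[] /eqP ->; lra.
Qed.

Lemma hull_fiberP n (X : seq 'cV[R]_n.+1) gu gl y x :
  hull (facet 1 gu X) y -> hull (facet (-1) gl X) y ->
  hull X (ccons x y) <-> x \in `[facet_height (-1) gl X y, facet_height 1 gu X y].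
Proof.
have [->|X0] := eqVneq X [::]; first by move=> /hull_neq0.
have p1 : (1 : R) * 1 = 1 by rewrite mulr1.
have n1 : (-1 : R) * -1 = 1 by rewrite mulrNN mulr1.
move=> /(hull_facetP _ _ p1 X0) hu /(hull_facetP _ _ n1 X0) hl.
rewrite in_itv /= -/(facet_height _ _ _ _); split=> [hx|/andP[lx xu]].
  have := hull_le_facet gu p1 hx; have := hull_le_facet gl n1 hx.
  rewrite !ccons_head !ccons_tail -!/(facet_height _ _ _ _) => *.
  by apply/andP; split; lra.
have [s sP] := hull_halfspaces X; apply/sP => c cs.
have := (sP _).1 hu c cs; have := (sP _).1 hl c cs.
rewrite !pairing_split !ccons_head !ccons_tail -!/(facet_height _ _ _ _).
move: lx xu; set l := facet_height _ _ _ _; set u := facet_height _ _ _ _.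
move: (rhead _) (pairing _ _) c.2 => r p q lx xu hl' hu'.
have [r0|r0] := leP 0 r.
  have := ler_wpM2l r0 lx; lra.
have := ler_wnM2l (ltW r0) xu; lra.
Qed.

Lemma moment_fun_ccons n (X : seq 'cV[R]_n.+1) k t xi x y :
  moment_fun X k t xi (ccons x y) =
  \1_(hull X) (ccons x y) * ((t + pairing (rtail xi) y) + rhead xi * x) ^+ k.
Proof.
by rewrite /moment_fun pairing_split ccons_head ccons_tail addrA addrAC.
Qed.

Definition facet_term n (X : seq 'cV[R]_n.+1) k t (xi : 'rV[R]_n.+1) sg g :
    'cV[R]_n -> R :=
  moment_fun (facet sg g X) k.+1 (t + rhead xi * facet_offset sg g X)
    (rtail xi + rhead xi *: g).

Lemma facet_termE n (X : seq 'cV[R]_n.+1) k t xi sg g y :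
  facet_term X k t xi sg g y = \1_(hull (facet sg g X)) y *
    ((t + pairing (rtail xi) y) + rhead xi * facet_height sg g X y) ^+ k.+1.
Proof.
rewrite /facet_term /moment_fun pairingDl pairingZl /facet_height.
congr (_ * _ ^+ _); ring.
Qed.

(** If no two slopes in G give the same height over y, then only one upper and one
    lower facet contribute to the sum, namely those where the line over y leaves
    the hull; the formula is then the fundamental theorem of calculus for a power
    of an affine function. *)
Lemma fiber_integral n (X : seq 'cV[R]_n.+1) (G : seq 'rV[R]_n) k t xi y :
  uniq G -> rhead xi != 0 ->
  (forall sg x, sg \in signs -> hull X (ccons x y) ->
     exists2 g, g \in G & hull (facet sg g X) y) ->
  (forall sg g g', sg \in signs -> g \in G -> g' \in G -> g != g' ->
     facet_height sg g X y != facet_height sg g' X y) ->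
  (\int[leb]_x (moment_fun X k t xi (ccons x y))%:E =
   (\sum_(sg <- signs) \sum_(g <- G)
      sg / (k.+1%:R * rhead xi) * facet_term X k t xi sg g y)%:E)%E.
Proof.
move=> Gu xi0 Gslope Gdist.
have [[x0 Xx0]|empty] := pselect (exists x, hull X (ccons x y)); last first.
  have X0 sg g : sg \in signs -> ~ hull (facet sg g X) y.
    move=> sgs; have [->|X0] := eqVneq X [::]; first by move=> /hull_neq0.
    move=> /(hull_facetP _ _ (signs_sqr sgs) X0) h.
    by apply: empty; eexists; exact: h.
  rewrite integral0_eq => [|x _]; last first.
    rewrite /moment_fun indicE memNset ?mul0r // => h.
    by apply: empty; exists x.
  rewrite big_seq big1 // => sg sgs; rewrite big1 // => g _.
  by rewrite facet_termE indicE memNset ?mul0r ?mulr0 //; exact: X0.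
have sumG sg g : sg \in signs -> g \in G -> hull (facet sg g X) y ->
    \sum_(g' <- G) sg / (k.+1%:R * rhead xi) * facet_term X k t xi sg g' y =
    sg / (k.+1%:R * rhead xi) *
    ((t + pairing (rtail xi) y) + rhead xi * facet_height sg g X y) ^+ k.+1.
  move=> sgs gG Fy; rewrite (bigD1_seq g) //= big_seq_cond big1 ?addr0.
    by rewrite facet_termE indicE mem_set // mul1r.
  move=> g' /andP[g'G g'g]; rewrite facet_termE indicE memNset ?mul0r ?mulr0 //.
  move=> Fy'; have := Gdist sg _ _ sgs g'G gG g'g.
  by rewrite (facet_height_uniq sgs Fy' Fy) eqxx.
have s1 : 1 \in signs by rewrite mem_head.
have sN1 : -1 \in signs by rewrite !inE eqxx orbT.
have [gu guG Fu] := Gslope _ _ s1 Xx0.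
have [gl glG Fl] := Gslope _ _ sN1 Xx0.
rewrite big_cons big_seq1 (sumG _ gu) // (sumG _ gl) //.
set l := facet_height (-1) gl X y; set u := facet_height 1 gu X y.
have fib x : hull X (ccons x y) <-> x \in `[l, u] by exact: hull_fiberP.
have lu : l <= u.
  by move/fib : Xx0; rewrite in_itv /= => /andP[]; exact: le_trans.
transitivity (\int[leb]_(x in `[l, u])
    ((t + pairing (rtail xi) y + rhead xi * x) ^+ k)%:E)%E; last first.
  rewrite integral_affine_power //; congr (_%:E).
  by rewrite mul1r mulN1r mulNr -mulrBr mulrC.
rewrite [RHS]integral_mkcond; apply: eq_integral.
move=> x _; rewrite moment_fun_ccons patchE indicE.
have -> : (ccons x y \in hull X) = (x \in `[l, u]%classic).
  by apply/idP/idP; rewrite !inE /= => /fib.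
by case: ifP; rewrite ?mul1r ?mul0r.
Qed.

(** Two facets of different slopes have the same height over a hyperplane only. *)
Lemma facet_height_ae n (X : seq 'cV[R]_n.+1) (G : seq 'rV[R]_n) :
  {ae @tuple_measure R n, forall y, forall sg, sg \in signs ->
    forall g, g \in G -> forall g', g' \in G ->
    g != g' -> facet_height sg g X (colt y) != facet_height sg g' X (colt y)}.
Proof.
apply: near_all_seq => sg _; apply: near_all_seq => g _; apply: near_all_seq => g' _.
have [->|gg'] := eqVneq g g'; first exact: nearW.
exists [set y | pairing (g - g') (colt y) = facet_offset sg g' X - facet_offset sg g X].
split.
- exact: measurable_hyperplane.
- by apply: hyperplane_null; rewrite subr_eq0.
- move=> y /= /not_implyP[_ /negP]; rewrite negbK /facet_height => /eqP.
  rewrite pairingDl -scaleN1r pairingZl; lra.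
Qed.

(** Fubini's theorem with the first coordinate innermost.  The list G only has to
    be rich enough: slopes that do not belong to a facet contribute nothing, so a
    common list can serve several hulls. *)
Lemma moment_succ n (X : seq 'cV[R]_n.+1) (G : seq 'rV[R]_n) k t xi :
  uniq G -> rhead xi != 0 ->
  (forall sg x y, sg * sg = 1 -> hull X (ccons x y) ->
     exists2 g, g \in G & hull (facet sg g X) y) ->
  moment X k t xi = \sum_(sg <- signs) \sum_(g <- G)
    sg / (k.+1%:R * rhead xi) *
    moment (facet sg g X) k.+1 (t + rhead xi * facet_offset sg g X)
      (rtail xi + rhead xi *: g).
Proof.
move=> Gu xi0 Gslope.
pose f (y : tupleR n.+1) := (moment_fun X k t xi (colt y))%:E.
pose h (p : R * 'rV[R]_n) (y : tupleR n) := facet_term X k t xi p.1 p.2 (colt y).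
pose c (p : R * 'rV[R]_n) : R := p.1 / (k.+1%:R * rhead xi).
pose s := [seq (sg, g) | sg <- signs, g <- G].
have mh p : mu.-integrable setT (EFin \o h p) by exact: integrable_moment.
have mf : measurable_fun setT f by exact: (measurable_int _ (integrable_moment X k t xi)).
have fi : (leb \x mu)%E.-integrable setT (f \o @consp R n).
  apply: (@integrable_moment_fun _ _ _ (leb \x mu)%E _ (@colt R n.+1 \o @consp R n)).
  - exact: (measurableT_comp (measurable_pairing xi) (@measurable_consp R n)).
  - by have := @measurable_consp R n measurableT _ (measurable_hull X); rewrite setTI.
  - exact: (hull_finite_measure X).
have intE : (\int[mu]_y f y = \int[mu]_y (\sum_(p <- s) c p * h p y)%:E)%E.
  transitivity (\int[(leb \x mu)%E]_p (f \o @consp R n) p)%E.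
    exact: (integral_pushforward (@measurable_consp R n) mf fi measurableT).
  rewrite -(integral21_prod_meas1 fi); apply: ae_eq_integral => //.
  - exact: (measurable_fubini_G fi).
  - apply/measurable_EFinP; apply: measurable_sum => p; apply: measurable_funM => //.
    by have /measurable_EFinP := measurable_int _ (mh p).
  apply: filterS (facet_height_ae X G) => y Gdist _; rewrite /fubini_G /=.
  under eq_integral do rewrite /f colt_consp /=.
  rewrite (fiber_integral _ _ Gu xi0) //=.
  - by rewrite big_allpairs.
  - by move=> sg x /signs_sqr; exact: Gslope.
  - by move=> sg g g' sgs gG g'G; exact: Gdist.
rewrite /moment /Rintegral -/f intE -/(Rintegral _ _ _) Rintegral_sum //.
by rewrite big_allpairs.
Qed.

End Recursion.

(** * Cancellation of moments *)

Section Vanishing.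
Variable R : realType.
Local Notation signs := (@signs R).

(** The linear forms met in the recursion are pairings of xi with nonzero vectors,
    so this makes all the divisions legitimate eventually. *)
Definition generic S (F : set_system S) n (xi : S -> 'rV[R]_n) :=
  forall b : 'cV[R]_n, b != 0 -> \forall s \near F, pairing (xi s) b != 0.

Definition exposed_at n (X : seq 'cV[R]_n) (v : 'rV[R]_n) (a : 'cV[R]_n) :=
  a \in X /\ forall b, b \in X -> b != a -> pairing v b < pairing v a.

Lemma near_lt_perturbed (p q d e : R) : p < q \/ p = q /\ d < e ->
  \forall r \near 0^'+, p + r * d < q + r * e.
Proof.
case=> [pq|[-> de]]; near=> r; last first.
  by rewrite ltrD2l ltr_pM2l.
have r0 : 0 < r by [].
have : r * (`|d| + `|e| + 1) < q - p.
  rewrite -ltr_pdivlMr; last by rewrite ltr_wpDl // addr_ge0.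
  by near: r; apply: nbhs_right_lt; apply: divr_gt0; rewrite ?subr_gt0 // ltr_wpDl ?addr_ge0.
have := ler_wpM2l (ltW r0) (ler_norm d); have := ler_wpM2l (ltW r0) (ler_norm (- e)).
rewrite normrN !mulrDr mulrN mulr1; lra.
Unshelve. all: by end_near. Qed.

(** Tilting the normal of a facet slightly in a direction that exposes a vertex in
    the facet gives a direction that exposes this vertex in the whole hull.  A
    single tilt works for all members of the family, whose facets share their
    slope. *)
Lemma exposed_lift n (I : finType) (X : I -> seq 'cV[R]_n.+1) sg g
    (w : 'rV[R]_n) (a : I -> 'cV[R]_n) :
  sg * sg = 1 -> (forall i, X i != [::]) ->
  (forall i, exposed_at (facet sg g (X i)) w (a i)) ->
  exists v, forall i,
    exposed_at (X i) v (ccons (facet_offset sg g (X i) + pairing g (a i)) (a i)).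
Proof.
move=> sg2 X0 aP.
pose A i := ccons (facet_offset sg g (X i) + pairing g (a i)) (a i).
have AX i : A i \in X i by apply: mem_facet => //; case: (aP i).
have Amax i : pairing (slope_dir sg g) (A i) = Defs.support (hull (X i)) (slope_dir sg g).
  by apply/slope_dir_supportP; rewrite // ccons_head ccons_tail.
have : \forall r \near 0^'+, forall i, i \in index_enum I -> forall b, b \in X i ->
    b != A i -> pairing (slope_dir sg g) b + r * pairing w (ctail b) <
                pairing (slope_dir sg g) (A i) + r * pairing w (a i).
  apply: near_all_seq => i _; apply: near_all_seq => b bX.
  have [->|bA] := eqVneq b (A i); first exact: nearW.
  suff h : pairing (slope_dir sg g) b < pairing (slope_dir sg g) (A i) \/
      pairing (slope_dir sg g) b = pairing (slope_dir sg g) (A i) /\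
      pairing w (ctail b) < pairing w (a i).
    by apply: filterS (near_lt_perturbed h) => r hr _.
  have [_ /(_ _ (mem_hull bX))] := support_hullP (slope_dir sg g) (X0 i).
  rewrite -Amax le_eqVlt => /predU1P[bE|]; [right; split=> //|by left].
  have [_ amax] := aP i; apply: amax.
    by apply: map_f; rewrite mem_filter bE Amax eqxx.
  apply: contraNneq bA => ba; move: bE; rewrite Amax.
  by move/(slope_dir_supportP _ _ _ sg2); rewrite ba => hb; rewrite /A -hb -ba cconsK.
move=> /filter_ex[r rP]; exists (slope_dir sg g + r *: rowcons 0 w) => i.
split=> [|b bX bA]; first exact: AX.
have E z : pairing (slope_dir sg g + r *: rowcons 0 w) z =
    pairing (slope_dir sg g) z + r * pairing w (ctail z).
  rewrite pairingDl pairingZl; congr (_ + r * _).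
  by rewrite pairing_rowcons mul0r add0r.
by rewrite !E ccons_tail; apply: rP => //; exact: mem_index_enum.
Qed.

Lemma moment_dim0 (X : seq 'cV[R]_0) k t xi : X != [::] -> moment X k t xi = t ^+ k.
Proof.
move=> X0; rewrite /moment /Rintegral (@integral_dirac _ _ ([tuple] : 0.-tuple (measurableTypeR R)) _ setT) //; last first.
  exact: (measurable_int _ (integrable_moment X k t xi)).
rewrite [X in (X * _)%E](_ : _ = 1%E) ?mul1e; last by rewrite /= diracE mem_set.
have [[a aX _] _] := support_hullP 0 X0.
rewrite /moment_fun indicE mem_set ?mul1r.
  by rewrite /pairing thinmx0 mul0mx mxE addr0.
by apply: mem_hull; rewrite (_ : colt _ = a) // [LHS]flatmx0 [RHS]flatmx0.
Qed.

(** The hypothesis on vertices passes to the facets of a given slope: there t_i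
    absorbs the height of the facet of X_i, so that t_i + <xi, a_i> is unchanged
    when a vertex is projected, while the power n + k stays the same because the
    degree grows as the dimension drops. *)
Theorem moment_vanish n S (F : set_system S) (FF : Filter F) (I : finType)
    (c : I -> R) (X : I -> seq 'cV[R]_n) (t : I -> S -> R) (xi : S -> 'rV[R]_n) k :
  (forall i, X i != [::]) -> generic F xi ->
  (forall v a, (forall i, exposed_at (X i) v (a i)) ->
     \forall s \near F, \sum_i c i * (t i s + pairing (xi s) (a i)) ^+ (n + k) = 0) ->
  \forall s \near F, \sum_i c i * moment (X i) k (t i s) (xi s) = 0.
Proof.
elim: n X t xi k => [|n IHn] X t xi k X0 xigen vanish.
  have a0 (a : 'cV[R]_0) : a = 0 by rewrite flatmx0.
  have : forall i, exposed_at (X i) 0 0.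
    move=> i; have [[a aX _] _] := support_hullP 0 (X0 i).
    by split=> [|b _]; [rewrite -(a0 a)|rewrite (a0 b) eqxx].
  move=> /(vanish 0 (fun=> 0)); apply: filterS => s; rewrite add0n => s0; rewrite -[RHS]s0.
  by apply: eq_bigr => i _; rewrite moment_dim0 // pairing0 addr0.
have [G GP] := choice (fun i => facet_slopes (X i)).
(* Slopes serving all members of the family at once. *)
pose H := undup (flatten [seq G i | i <- index_enum I]).
have HP i sg x y : sg * sg = 1 -> hull (X i) (ccons x y) ->
    exists2 g, g \in H & hull (facet sg g (X i)) y.
  move=> sg2 /(GP i _ _ _ sg2)[g gG hg]; exists g => //.
  rewrite mem_undup; apply/flattenP; exists (G i) => //.
  by apply: map_f; exact: mem_index_enum.
have facets : \forall s \near F, forall sg, sg \in signs -> forall g, g \in H ->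
    \sum_i c i * moment (facet sg g (X i)) k.+1
      (t i s + rhead (xi s) * facet_offset sg g (X i))
      (rtail (xi s) + rhead (xi s) *: g) = 0.
  apply: near_all_seq => sg sgs; apply: near_all_seq => g _.
  have sg2 := signs_sqr sgs.
  apply: IHn => [i|b b0|w a aP]; first exact: facet_neq0.
    have : ccons (pairing g b) b != 0.
      by apply: contraNneq b0 => /(congr1 (@ctail R n)); rewrite ccons_tail linear0 => ->.
    move=> /xigen; apply: filterS => s.
    by rewrite pairing_split ccons_head ccons_tail pairingDl pairingZl addrC.
  have [v vP] := exposed_lift sg2 X0 aP.
  apply: filterS (vanish v _ vP) => s s0; rewrite -[RHS]s0.
  apply: eq_bigr => i _; rewrite addnS; congr (_ * _ ^+ _).
  rewrite pairing_split ccons_head ccons_tail pairingDl pairingZl; ring.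
have xi0 : \forall s \near F, rhead (xi s) != 0.
  have : ccons 1 (0 : 'cV[R]_n) != 0.
    apply/eqP => /(congr1 (@chead R n)); rewrite ccons_head linear0.
    by apply/eqP; rewrite oner_eq0.
  move=> /xigen; apply: filterS => s.
  by rewrite pairing_split ccons_head ccons_tail pairing0 mulr1 addr0.
apply: filterS2 facets xi0 => s fs x0.
under eq_bigr do rewrite (moment_succ _ _ (undup_uniq _) x0 (HP _)) mulr_sumr.
rewrite exchange_big big_seq big1 // => sg sgs.
under eq_bigr do rewrite mulr_sumr.
rewrite exchange_big big_seq big1 // => g gH.
under eq_bigr do rewrite mulrCA.
by rewrite -mulr_sumr fs // mulr0.
Qed.

End Vanishing.

(** * Volumes are determined by powers of support functions *)

Section SupportPowers.
Variable R : realType.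

(** Dividing by X - r for a natural root r lowers the degree. *)
Lemma near_horner_neq0 (p : {poly R}) :
  p != 0 -> \forall s \near \oo, p.[s%:R] != 0.
Proof.
have [m] := ubnP (size p); elim: m p => // m IHm p pm p0.
have [[r pr]|noroot] := pselect (exists r : nat, root p r%:R); last first.
  by apply: nearW => s; apply/negP => ps; apply: noroot; exists s.
have [q pE] := factor_theorem _ _ pr.
have q0 : q != 0 by apply: contraNneq p0; rewrite pE => ->; rewrite mul0r.
have qm : (size q < m)%N.
  by move: pm; rewrite pE size_Mmonic ?monicXsubC // size_XsubC addn2 /= ltnS.
apply: filterS2 (IHm q qm q0) (nbhs_infty_gt r) => s qs rs.
rewrite pE hornerM hornerXsubC mulf_neq0 // subr_eq0 eqr_nat.
by rewrite gtn_eqF.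
Qed.

Definition moment_curve n (s : nat) : 'rV[R]_n := \row_i s%:R ^+ i.

(** The pairing of the curve with b is the polynomial with coefficients b. *)
Lemma moment_curve_generic n : generic \oo (@moment_curve n).
Proof.
move=> b b0; pose p := \poly_(i < n) (if insub i is Some j then b j 0 else 0).
have pE s : pairing (moment_curve n s) b = p.[s%:R].
  rewrite pairingE horner_poly; apply: eq_bigr => i _.
  by rewrite mxE (insubT (fun j => j < n)%N (ltn_ord i)) mulrC; congr (b _ _ * _);
    apply: val_inj.
under eq_near do rewrite pE; apply: near_horner_neq0.
apply: contraNneq b0 => p0; apply/eqP/colP => j; rewrite mxE.
have := congr1 (fun q : {poly R} => q`_j) p0.
rewrite coef_poly coef0 ltn_ord (insubT (fun i => i < n)%N (ltn_ord j)) => <-.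
by congr (b _ _); apply: val_inj.
Qed.

Definition hull_volume n (X : seq 'cV[R]_n) : R := moment X 0 0 0.

Lemma moment_degree0 n (X : seq 'cV[R]_n) t xi : moment X 0 t xi = hull_volume X.
Proof. by apply: eq_Rintegral => y _; rewrite /moment_fun !expr0. Qed.

Lemma volume_hull n (X : seq 'cV[R]_n) : volume (hull X) = (hull_volume X)%:E.
Proof.
rewrite /hull_volume /moment /Rintegral /volume -tuple_measureE.
under eq_integral do rewrite /moment_fun expr0 mulr1.
rewrite (_ : (fun y => _) = (fun y => (\1_[set t | hull X (colt t)] y)%:E)).
  rewrite integral_indic //; last exact: measurable_hull.
  by rewrite setIT fineK // ge0_fin_numE //; exact: hull_finite_measure.
by apply/funext => y; rewrite !indicE; congr (_%:R%:E); apply/idP/idP; rewrite !inE.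
Qed.

(** If v exposes a_i in X_i, so does s v + xi for s large, and the hypothesis there
    says that the polynomial sum_i c_i <s v + xi, a_i>^n in s vanishes.  Hence it
    vanishes at s = 0 as well. *)
Lemma exposed_power_sum n (I : finType) (c : I -> R) (X : I -> seq 'cV[R]_n) v a :
  (forall u, \sum_i c i * Defs.support (hull (X i)) u ^+ n = 0) ->
  (forall i, exposed_at (X i) v (a i)) ->
  forall xi, \sum_i c i * pairing xi (a i) ^+ n = 0.
Proof.
move=> sum0 aP xi.
pose q : {poly R} :=
  \sum_i c i *: ((pairing v (a i))%:P * 'X + (pairing xi (a i))%:P) ^+ n.
have qE s : q.[s] = \sum_i c i * pairing (s *: v + xi) (a i) ^+ n.
  rewrite horner_sum; apply: eq_bigr => i _.
  rewrite hornerZ horner_exp hornerD hornerM !hornerC hornerX.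
  by rewrite pairingDl pairingZl mulrC [_ * s]mulrC mulrC.
have exposed : \forall s \near \oo, forall i, i \in index_enum I ->
    forall b, b \in X i -> pairing (s%:R *: v + xi) b <= pairing (s%:R *: v + xi) (a i).
  apply: near_all_seq => i _; apply: near_all_seq => b bX.
  have [->|ba] := eqVneq b (a i); first exact: nearW.
  have [_ /(_ b bX ba)] := aP i; rewrite -subr_gt0 => vb.
  apply: filterS (nbhs_infty_gtr ((pairing xi b - pairing xi (a i)) /
    (pairing v (a i) - pairing v b))) => s.
  by rewrite ltr_pdivrMr // !pairingDl !pairingZl; lra.
have q0 : q = 0.
  apply/eqP; apply: contraT => /near_horner_neq0 qn0.
  have [s [/negP qs sP]] := filter_ex (filterI qn0 exposed); case: qs.
  rewrite qE; apply/eqP; rewrite -[RHS](sum0 (s%:R *: v + xi)).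
  apply: eq_bigr => i _; congr (_ * _ ^+ _); apply/esym.
  have [aX _] := aP i.
  apply: Defs.supportE; first exact: mem_hull.
  exact: support_hull aX (sP i (mem_index_enum i)).
rewrite -[RHS](horner0 (0 : R)) -q0 qE.
by apply: eq_bigr => i _; rewrite scale0r add0r.
Qed.

Theorem support_power_volume n (I : finType) (c : I -> R) (X : I -> seq 'cV[R]_n) :
  (forall i, X i != [::]) ->
  (forall u, \sum_i c i * Defs.support (hull (X i)) u ^+ n = 0) ->
  \sum_i c i * hull_volume (X i) = 0.
Proof.
move=> X0 sum0.
have /filter_ex[s] : \forall s \near \oo,
    \sum_i c i * moment (X i) 0 0 (moment_curve n s) = 0.
  apply: moment_vanish => [//||v a aP]; first exact: moment_curve_generic.
  apply: nearW => s; rewrite addn0 -[RHS](exposed_power_sum sum0 aP (moment_curve n s)).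
  by apply: eq_bigr => i _; rewrite add0r.
by under eq_bigr do rewrite moment_degree0.
Qed.

End SupportPowers.

(** * Extension of linear functionals *)

Section Extension.
Variables (K : fieldType) (V : lmodType K).

(** The graph of a linear functional on a subspace: closed under linear
    combinations and single-valued. *)
Definition linear_graph (G : set (V * K)) : Prop :=
  (forall a v w r s, G (v, r) -> G (w, s) -> G (a *: v + w, a * r + s)) /\
  (forall r, G (0, r) -> r = 0).

(** Zorn's lemma is applied to the sets A for which A together with G is such a
    graph; in this form the union of the empty chain is covered too. *)
Lemma linear_graph_total (G : set (V * K)) : linear_graph G -> G (0, 0) ->
  exists D : {linear V -> K^o}, forall v r, G (v, r) -> D v = r.
Proof.
move=> [Glin Gfun] G00.
pose P (A : set (V * K)) := linear_graph (A `|` G).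
have [A [[Alin Afun] Amax]] : exists A, P A /\ forall B, A `<` B -> ~ P B.
  apply: Zorn_bigcup => F FP Ftot; split.
    move=> a v w r s Hv Hw.
    have [[B [BG vB wB]]|[vG wG]] : (exists B, [/\ B = set0 \/ F B,
        (B `|` G) (v, r) & (B `|` G) (w, s)]) \/ (G (v, r) /\ G (w, s)).
      case: Hv Hw => [[B FB Bv]|Gv] [[C FC Cw]|Gw]; last by right.
      - left; have [BC|CB] := Ftot _ _ FB FC.
          by exists C; split; [right|left; exact: BC|left].
        by exists B; split; [right|left|left; exact: CB].
      - by left; exists B; split; [right|left|right].
      - by left; exists C; split; [right|right|left].
    case: BG => [B0|FB].
      by right; move: vB wB; rewrite B0 !set0U; exact: Glin.
    have [Blin _] := FP _ FB.
    by have [|] := Blin a _ _ _ _ vB wB; [left; exists B|right].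
    by right; exact: Glin.
  move=> r [[B FB B0]|/Gfun //]; have [_ Bfun] := FP _ FB.
  by apply: Bfun; left.
have total v : exists r, (A `|` G) (v, r).
  apply: contrapT => nv.
  (* Otherwise the graph can be extended by the value 0 at v. *)
  pose B : set (V * K) :=
    [set p | exists w a, (A `|` G) (w, p.2) /\ p.1 = w + a *: v].
  have AGB : A `|` G `<=` B.
    by move=> [w r] H; exists w, 0; rewrite scale0r addr0.
  apply: (Amax B).
    split=> [p Ap|BA]; first by apply: AGB; left.
    by apply: nv; exists 0; left; apply: BA; exists 0, 1; rewrite add0r scale1r; split=> //; right.
  rewrite /P setUidl; last by move=> p Gp; apply: AGB; right.
  split=> [a _ _ r s [w [b [/= Hw ->]]] [w' [b' [/= Hw' ->]]]|r [w [a [/= Hw E]]]].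
    exists (a *: w + w'), (a * b + b'); split; first exact: Alin.
    by rewrite /= scalerDr scalerDl scalerA addrACA.
  have [a0|a0] := eqVneq a 0.
    by apply: Afun; rewrite E a0 scale0r addr0.
  exfalso; apply: nv; exists (- a^-1 * r + 0).
  rewrite (_ : v = - a^-1 *: w + 0).
    by apply: Alin => //; right.
  move/eqP: E; rewrite eq_sym addr_eq0 => /eqP ->.
  by rewrite addr0 scalerN scaleNr opprK scalerA mulVf // scale1r.
have [D DP] := choice total.
have uniq_val v r s : (A `|` G) (v, r) -> (A `|` G) (v, s) -> r = s.
  move=> Hr Hs; have := Alin (-1) _ _ _ _ Hr Hs.
  rewrite scaleN1r addNr => /Afun; rewrite mulN1r addrC => /eqP.
  by rewrite subr_eq0 => /eqP.
have Dlin : linear (D : V -> K^o).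
  by move=> a v w; apply: (uniq_val (a *: v + w)) => //; exact: Alin.
pose Dmix := GRing.isLinear.Build K V K^o *:%R D Dlin.
pose Dl : {linear V -> K^o} := HB.pack D Dmix.
by exists Dl => v r Gv; apply: (uniq_val v) => //; right.
Qed.

Lemma linear_extension (I : Type) (f : I -> V) (m : I -> K) :
  (forall s : seq (K * I), \sum_(p <- s) p.1 *: f p.2 = 0 ->
     \sum_(p <- s) p.1 * m p.2 = 0) ->
  exists D : {linear V -> K^o}, forall i, D (f i) = m i.
Proof.
move=> fm.
pose G : set (V * K) := [set p | exists s : seq (K * I),
  p.1 = \sum_(q <- s) q.1 *: f q.2 /\ p.2 = \sum_(q <- s) q.1 * m q.2].
have [||D DP] := @linear_graph_total G.
- split=> [a _ _ _ _ [s [/= -> ->]] [s' [/= -> ->]]|r [s [/= /esym E ->]]]; last exact: fm.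
  exists ([seq (a * q.1, q.2) | q <- s] ++ s'); rewrite /= !big_cat !big_map /=.
  rewrite scaler_sumr mulr_sumr; split; congr (_ + _); apply: eq_bigr => q _.
    by rewrite scalerA.
  by rewrite mulrA.
- by exists [::]; rewrite /= !big_nil.
exists D => i; apply: DP; exists [:: (1, i)].
by rewrite /= !big_seq1 scale1r mul1r.
Qed.

End Extension.

(** * Minkowski combinations *)

Section Minkowski.
Variables (R : realType) (n : nat).
Implicit Types X Y : seq 'cV[R]_n.

Lemma polytope_hull (A : polytope R n) :
  exists X, X != [::] /\ polytope_set A = hull X.
Proof.
have [S [/finite_seqP[X ->] [a aX] ->]] := polytopeP A.
by exists X; split=> //; apply/eqP => X0; move: aX; rewrite X0.
Qed.

Lemma hull_polytopeP X : X != [::] -> exists Y : set 'cV[R]_n,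
  [/\ finite_set Y, Y !=set0 & hull X = convex_hull Y].
Proof.
move=> X0; exists [set x | x \in X]; split=> //.
by have [[a aX _] _] := support_hullP 0 X0; exists a.
Qed.

Definition hull_polytope X (X0 : X != [::]) : polytope R n :=
  Polytope (hull_polytopeP X0).

Lemma convex_hull_hull X : convex_hull (hull X) `<=` hull X.
Proof.
have [s sP] := hull_halfspaces X.
move=> _ [k [a [w [aX w0 w1 ->]]]]; apply/sP => c cs.
rewrite pairing_sum -[c.2]mul1r -w1 mulr_suml -big_split /=.
apply: sumr_ge0 => i _; rewrite -mulrDr mulr_ge0 //.
exact: (sP _).1 (aX i) c cs.
Qed.

(** In a sum of points of convex hulls the points can be replaced one at a time
    by convex combinations of generators. *)
Lemma convex_sum_ind (C : set 'cV[R]_n) (I : finType) (x : I -> R)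
    (X : I -> seq 'cV[R]_n) : convex_hull C `<=` C ->
  (forall a, (forall i, a i \in X i) -> C (\sum_i x i *: a i)) ->
  forall a, (forall i, hull (X i) (a i)) -> C (\sum_i x i *: a i).
Proof.
move=> Cconv CX.
suff H (r : seq I) (a : I -> 'cV[R]_n) : (forall i, i \in r -> hull (X i) (a i)) ->
    (forall i, i \notin r -> a i \in X i) -> C (\sum_i x i *: a i).
  by move=> a aX; apply: (H (enum I) a) => // i; rewrite mem_enum.
elim: r a => [|i r IHr] a ar anr; first by apply: CX => i; exact: anr.
have [k [b [w [bX w0 w1 aE]]]] := ar i (mem_head i r).
pose a' j l := if l == i then b j else a l.
apply: Cconv; exists k, (fun j => \sum_l x l *: a' j l), w; split=> //.
  move=> j; apply: IHr => l; rewrite /a'; case: eqP => [->|/eqP li] lr.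
  - exact/mem_hull/bX.
  - by apply: ar; rewrite inE lr orbT.
  - exact: bX.
  - by apply: anr; rewrite inE negb_or li.
under [RHS]eq_bigr do rewrite scaler_sumr.
rewrite exchange_big; apply: eq_bigr => l _ /=; rewrite /a'.
under [RHS]eq_bigr do rewrite scalerA mulrC -scalerA.
rewrite -scaler_sumr; congr (_ *: _); case: eqP => [-> //|_].
by rewrite -scaler_suml w1 scale1r.
Qed.

Lemma minkowski_comb_hull (x : 'I_n -> R) (X : 'I_n -> seq 'cV[R]_n) :
  (forall i, X i != [::]) ->
  exists Y, Y != [::] /\ minkowski_comb x (fun i => hull (X i)) = hull Y.
Proof.
move=> X0.
(* Choices of one point in each X_i, as functions into one ordinal; an index out
   of range stands for the first point. *)
pose m := \sum_i size (X i).
pose pt (f : {ffun 'I_n -> 'I_m.+1}) i := nth (nth 0 (X i) 0) (X i) (f i).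
have ptX f i : pt f i \in X i.
  rewrite /pt; have [fi|fi] := ltnP (f i) (size (X i)); first exact: mem_nth.
  rewrite nth_default // mem_nth //.
  by move: (X0 i); rewrite -size_eq0 lt0n.
have Xpt (a : 'I_n -> 'cV[R]_n) : (forall i, a i \in X i) -> exists f, forall i, pt f i = a i.
  move=> aX; exists [ffun i => inord (index (a i) (X i))] => i.
  rewrite /pt ffunE inordK ?nth_index // ltnS; apply: leq_trans (index_size _ _) _.
  by rewrite /m (bigD1 i) //= leq_addr.
exists [seq \sum_i x i *: pt f i | f <- enum {ffun 'I_n -> 'I_m.+1}]; split.
  by rewrite -size_eq0 size_map -cardT card_ffun card_ord expn_eq0.
apply/seteqP; split=> [_ [a aX <-]|_ [k [b [w [bY w0 w1 ->]]]]].
  apply: (convex_sum_ind (X := X)) => //; first exact: convex_hull_hull.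
  move=> c /Xpt[f fc]; apply: mem_hull.
  under eq_bigr do rewrite -fc.
  by apply: map_f; rewrite mem_enum.
have /choice[f fb] : forall j, exists f, b j = \sum_i x i *: pt f i.
  by move=> j; have /mapP[f _ ->] := bY j; exists f.
exists (fun i => \sum_j w j *: pt (f j) i).
  move=> i; exists k, (fun j => pt (f j) i), w; split=> // j; exact: ptX.
under eq_bigr do rewrite scaler_sumr.
rewrite exchange_big; apply: eq_bigr => j _ /=.
rewrite fb scaler_sumr; apply: eq_bigr => i _.
by rewrite !scalerA mulrC.
Qed.

Lemma support_minkowski_comb (x : 'I_n -> R) (A : 'I_n -> polytope R n) v :
  (forall i, 0 <= x i) ->
  Defs.support (minkowski_comb x (fun i => polytope_set (A i))) v =
  \sum_i x i * Defs.support (A i) v.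
Proof.
move=> x0.
have /choice[a aP] : forall i, exists a, [/\ polytope_set (A i) a,
    Defs.support (A i) v = pairing v a &
    forall b, polytope_set (A i) b -> pairing v b <= pairing v a].
  by move=> i; have [a Aa [aE amax]] := support_max (A i) v; exists a.
rewrite (@Defs.supportE _ _ _ _ (\sum_i x i *: a i)).
- by rewrite pairing_sum; apply: eq_bigr => i _; have [_ -> _] := aP i.
- by exists a => // i; case: (aP i).
- move=> _ [b bA <-]; rewrite !pairing_sum; apply: ler_sum => i _.
  by have [_ _ amax] := aP i; rewrite ler_wpM2l // amax.
Qed.

End Minkowski.

(** * The functional and the mixed volume *)

Section MixedVolume.
Variables (R : realType) (n : nat).

Lemma cpoly_sumE (I : Type) (s : seq I) (c : I -> R) (f : I -> cpoly R n) v :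
  (\sum_(i <- s) c i *: f i : cpoly R n) v = \sum_(i <- s) c i * f i v.
Proof.
elim: s => [|i s IHs]; first by rewrite !big_nil.
by rewrite !big_cons -IHs.
Qed.

Lemma polytope_volume (A : polytope R n) : volume A = (fine (volume A))%:E.
Proof. by have [X [_ ->]] := polytope_hull A; rewrite volume_hull. Qed.

Lemma support_power_functional : exists D : {linear cpoly R n -> R^o},
  forall A : polytope R n, D (support_prod (fun=> A)) = n`!%:R * fine (volume A).
Proof.
apply: linear_extension => s s0.
have [X XP] := choice (@polytope_hull R n).
under eq_bigr do rewrite mulrCA.
rewrite -mulr_sumr (big_nth (0, hull_polytope (isT : [:: 0] != [::]))) big_mkord.
set p0 := (0, _).
pose Z (i : 'I_(size s)) := X (nth p0 s i).2.
have vE (i : 'I_(size s)) : fine (volume (nth p0 s i).2) = hull_volume (Z i).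
  by have [_ ->] := XP (nth p0 s i).2; rewrite volume_hull.
under eq_bigr do rewrite vE.
rewrite support_power_volume ?mulr0 // => [i|u]; first by case: (XP (nth p0 s i).2).
have := congr1 (fun f : cpoly R n => f u) s0; rewrite cpoly_sumE.
rewrite (big_nth p0) big_mkord => sum0; rewrite -[RHS]sum0.
apply: eq_bigr => i _; rewrite /= prodr_const card_ord.
by have [_ ->] := XP (nth p0 s i).2.
Qed.

(** The n-th power of sum_i x_i h_(A_i), multiplied out. *)
Lemma support_prod_minkowski (x : 'I_n -> R) (A : 'I_n -> polytope R n)
    (M : polytope R n) : (forall i, 0 <= x i) ->
  polytope_set M = minkowski_comb x (fun i => polytope_set (A i)) ->
  support_prod (fun=> M) = \sum_(f : {ffun 'I_n -> 'I_n})
    (\prod_j x (f j)) *: support_prod (fun j => A (f j)).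
Proof.
move=> x0 ME; apply/val_inj/funext => v; apply: etrans (esym (cpoly_sumE _ _ _ _)) => /=.
rewrite ME support_minkowski_comb // bigA_distr_bigA /=.
by apply: eq_bigr => f _; rewrite big_split.
Qed.

Definition monomial (f : 'I_n -> 'I_n) : mpoly n R := \prod_j mpolyX R (mnm1 (f j)).

Lemma meval_monomial x f : meval x (monomial f) = \prod_j x (f j).
Proof.
by rewrite /monomial rmorph_prod; apply: eq_bigr => j _; rewrite /= mevalXU.
Qed.

Lemma mcoeff_monomial f :
  mcoeff (Multinom [tuple 1%N | _ < n]) (monomial f) = (injectiveb f)%:R.
Proof.
have -> : monomial f = mpolyX R (\big[@mnm_add n/@mnm0 n]_j mnm1 (f j)).
  by rewrite /monomial (big_morph _ (@mpolyXD n R) (@mpolyX0 n R)).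
rewrite mcoeffX; congr (_%:R); congr nat_of_bool.
have count_preim k : (\big[@mnm_add n/@mnm0 n]_j mnm1 (f j)) k = (\sum_j (f j == k))%N.
  by rewrite mnm_sumE; apply: eq_bigr => j _; rewrite mnm1E.
apply/eqP/injectiveP => [E i j fij|finj].
  apply/eqP/negPn/negP => ij; move: (count_preim (f i)).
  rewrite E mnmE (bigD1 i) //= (bigD1 j) //=; last by rewrite eq_sym.
  by rewrite fij eqxx.
apply/mnmP => k; rewrite count_preim mnmE -(f_invF finj k).
rewrite (bigD1 (invF finj k)) //= eqxx big1 // => j jk.
by rewrite (inj_eq finj) (negbTE jk).
Qed.

End MixedVolume.

Theorem theorem1p2 (R : realType) (n : nat) (hn : (0 < n)%N) :
  exists D : {linear cpoly R n -> R^o},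
    forall A : 'I_n -> polytope R n,
      is_mixed_volume (fun i => polytope_set (A i)) (D (support_prod A)).
Proof.
have [D DP] := support_power_functional R n.
exists D => A.
have fact0 : n`!%:R != 0 :> R by rewrite pnatr_eq0 -lt0n fact_gt0.
(* The polynomial is D of the n-th power of sum_i x_i h_(A_i), divided by n!; only
   the n! permutations f contribute to the coefficient of x_1 ... x_n. *)
exists (n`!%:R^-1 *: \sum_(f : {ffun 'I_n -> 'I_n})
    D (support_prod (fun j => A (f j))) *: monomial R f).
  move=> x x0.
  have /choice[X XP] : forall i, exists X, X != [::] /\ polytope_set (A i) = hull X.
    by move=> i; exact: polytope_hull.
  have [Y [Y0 YE]] := minkowski_comb_hull x (fun i => (XP i).1).
  have ME : polytope_set (hull_polytope Y0) =
      minkowski_comb x (fun i => polytope_set (A i)).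
    rewrite /= -YE; congr (minkowski_comb x _); apply/funext => i.
    by have [_ ->] := XP i.
  rewrite -ME polytope_volume; congr (_%:E).
  apply: (mulfI fact0); rewrite -DP (support_prod_minkowski x0 ME).
  rewrite mevalZ mulrA divff // mul1r linear_sum raddf_sum.
  apply: eq_bigr => f _.
  by rewrite linearZ_LR /= mevalZ meval_monomial mulrC.
rewrite mcoeffZ raddf_sum /=.
under eq_bigr do rewrite mcoeffZ mcoeff_monomial.
rewrite (bigID (fun f : {ffun 'I_n -> 'I_n} => injectiveb f)) /=.
rewrite [X in _ + X]big1 ?addr0 => [|f /negbTE ->]; last by rewrite mulr0.
rewrite (eq_bigr (fun=> D (support_prod A))) => [|f finj]; last first.
  rewrite finj mulr1; congr (D _); apply/val_inj/funext => v /=.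
  have /injectiveP fi := finj.
  by rewrite [RHS](reindex_inj fi).
rewrite sumr_const -[X in _ * X]mulr_natl mulrA.
have -> : #|[pred f : {ffun 'I_n -> 'I_n} | injectiveb f]| = n`!.
  have := card_inj_ffuns 'I_n 'I_n; rewrite card_ord ffactnn => <-.
  by apply: eq_card => f; rewrite !inE.
by rewrite mulVf // mul1r.
Qed.
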